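(* Let $D(k)=\sum_{n=1}^\infty a_n n^{-k}$, where $(a_n)$ are the coefficients in $\prod_{n\ge1}(1-q^n)=\sum_{n\ge0}a_nq^n$. For every positive integer $k$, $$D(k)=\sum_{j=0}^k 6^{k-j}\binom{-k}{k-j}\frac{(2\pi)^j}{j!}\,g(j),$$ where $$g(j)=\begin{cases}-\dfrac12(-1)^{j/2}(2^j-2)(3^j-3)\,B_j & \text{if } j \text{ is even},\\[2mm] -\dfrac{1}{\sqrt3}(2^j+2)\,G^*(j) & \text{if } j\text{ is odd}.\end{cases}$$ Here $B_j$ are the Bernoulli numbers and $G^*(j)$ are the rescaled Glaisher $G$-numbers defined by $\sum_{n\ge0}G^*(n)\dfrac{x^n}{n!}=\dfrac{3x}{2+4\cos x}$.
   Context: The coefficients $a_n$ of Euler's pentagonal number theorem are: $a_0=1$; $a_n=(-1)^m$ if $n=(3m^2+m)/2$ or $n=(3m^2-m)/2$ for some positive integer $m$; and $a_n=0$ otherwise. The Bernoulli numbers are defined by $\sum_{n\ge0}B_n\frac{x^n}{n!}=\frac{x}{1-e^{-x}}$ (only even indices are used, so the sign convention for $B_1$ is immaterial). The generalized binomial coefficient is $\binom{-k}{m}=\frac{(-k)(-k-1)\cdots(-k-m+1)}{m!}$ for integers $m\ge0$. The first values of $G^*$ are $G^*(1)=\tfrac12$, $G^*(3)=1$, $G^*(5)=5$, $G^*(7)=49$, and $G^*(n)=0$ for even $n$. *)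

(* Defs.v *)
From mathcomp Require Import all_boot all_order all_algebra.
From mathcomp Require Import all_classical all_reals all_analysis.

Set Implicit Arguments.
Unset Strict Implicit.
Unset Printing Implicit Defensive.

Import Order.TTheory GRing.Theory Num.Theory.
Import numFieldNormedType.Exports.

Local Open Scope classical_set_scope.
Local Open Scope ring_scope.

Definition euler_prod (N : nat) : {poly int} :=
  \prod_(1 <= i < N.+1) (1 - 'X^i).

(* The factors with i > n do not affect the coefficient of q^n in the formal
   infinite product (see [euler_prod_stable]), so the partial product up to n
   suffices to read it off. *)
Definition euler_coef (n : nat) : int := (euler_prod n)`_n.

Lemma euler_prod_stable (n N : nat) :
  (n <= N)%N -> (euler_prod N)`_n = euler_coef n.
Proof.
move=> /subnK <-; elim: (N - n)%N => [|d IHd]; first by rewrite add0n.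
rewrite addSn /euler_prod big_nat_recr //= -/(euler_prod (d + n)).
rewrite mulrBr mulr1 coefB IHd coefMXn.
by rewrite ltnS leq_addl subr0.
Qed.

(* Since x / (1 - e^{-x}) is only a removable singularity at 0, and division by
   zero is total, the identity is required on a punctured neighbourhood of 0;
   this still determines every coefficient, including c 0. *)
Definition has_egf (R : realType) (c : nat -> R) (f : R -> R) : Prop :=
  \forall x \near 0^',
    (fun N : nat => \sum_(0 <= n < N) c n * (x ^+ n / n`!%:R)) @ \oo --> f x.

Definition is_bernoulli (R : realType) (B : nat -> R) : Prop :=
  has_egf B (fun x : R => x / (1 - expR (- x))).

Definition is_glaisherG (R : realType) (G : nat -> R) : Prop :=
  has_egf G (fun x : R => 3 * x / (2 + 4 * cos x)).

Definition gbinom (R : realType) (x : R) (m : nat) : R :=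
  (\prod_(i < m) (x - i%:R)) / m`!%:R.

Definition gcoef (R : realType) (B G : nat -> R) (j : nat) : R :=
  if odd j then - (1 / Num.sqrt 3) * (2 ^+ j + 2) * G j
  else - (1 / 2) * (-1) ^+ j./2 * (2 ^+ j - 2) * (3 ^+ j - 3) * B j.

(* Main.v *)
(* By Shanks's finite form of the pentagonal number theorem, D(k) is the sum of
   (-1)^m (2 / (m (3m + 1)))^k over the nonzero integers m. Partial fractions in
   the form "s r = s + r" with s = -1/(3m) and r = 1/(3m + 1) reduce it to the
   alternating sums of m^(-i) and (m + 1/3)^(-i), which are the Taylor
   coefficients of 1/x - pi/sin(pi x) - pi/sin(pi (x + 1/3)) at 0, by the
   expansion of pi/sin(pi z) into simple fractions. Trigonometric identities
   rewrite this function through y/sin y and 3y/(2 + 4 cos y) at rescaled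
   arguments, whose coefficients are given by the Bernoulli and Glaisher numbers
   (x/sinh x = 2 b(x) - b(2x) for b(x) = x/(1 - e^(-x)), then x is rotated to
   the imaginary axis on the level of coefficients).

   The cosecant expansion is obtained from the tripling formula for 1/sin, which
   the symmetric partial sums of order 1, 4, 13, 40, ... satisfy exactly: the
   Lipschitz constant of the error on (0, 1/2] is divided by 3 at each step,
   which makes the error itself tend to 0. *)
Require Import Defs.
From mathcomp Require Import all_boot all_order all_algebra.
From mathcomp Require Import all_classical all_reals all_analysis.
From mathcomp Require Import ring lra zify.

Set Implicit Arguments.
Unset Strict Implicit.
Unset Printing Implicit Defensive.

Import Order.TTheory GRing.Theory Num.Theory.
Import numFieldNormedType.Exports.
Local Open Scope classical_set_scope.
Local Open Scope ring_scope.

(** * The pentagonal number theorem *)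

(** The generalized pentagonal number (3m^2 - m)/2; [pent_plus] is (3m^2 + m)/2. This form avoids
    division and truncated subtraction and displays the lower bound m^2. *)
Definition pent_minus (m : nat) : nat := (m ^ 2 + 'C(m, 2))%N.

Definition pent_plus (m : nat) : nat := (m ^ 2 + 'C(m.+1, 2))%N.

Lemma doubled_bin2 (m : nat) : ('C(m.+1, 2) * 2 = m.+1 * m)%N.
Proof. by rewrite mulnC -mul_bin_diag bin1. Qed.

Lemma pent_minusE (m : nat) : (pent_minus m * 2 + m = 3 * m ^ 2)%N.
Proof.
case: m => [|m]; rewrite /pent_minus // mulnDl doubled_bin2; lia.
Qed.

Lemma pent_plusE (m : nat) : (pent_plus m * 2 = 3 * m ^ 2 + m)%N.
Proof. rewrite /pent_plus mulnDl doubled_bin2; lia. Qed.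

Lemma pent_minus_ge (m : nat) : (m ^ 2 <= pent_minus m)%N.
Proof. exact: leq_addr. Qed.

Lemma pent_plus_ge (m : nat) : (m ^ 2 <= pent_plus m)%N.
Proof. exact: leq_addr. Qed.

Lemma pent_minus_gt_plus (M m : nat) : (M < m -> pent_plus M < pent_minus m)%N.
Proof.
move=> ltMm; have := pent_minusE m; have := pent_plusE M; nia.
Qed.

Lemma pent_plus_gt_plus (M m : nat) : (M < m -> pent_plus M < pent_plus m)%N.
Proof.
move=> ltMm; have := pent_plusE m; have := pent_plusE M; nia.
Qed.

Definition shanks_prod (s n : nat) : {poly int} := \prod_(s.+1 <= i < n.+1) (1 - 'X^i).

(** Shanks's finite sum. Its [s = 0] term is Euler's product up to [n], and its other terms have
    order above [n]; as a whole it evaluates to a truncation of the pentagonal series. *)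
Definition shanks_sum (n : nat) : {poly int} :=
  \sum_(s < n.+1) (-1) ^+ s * shanks_prod s n * 'X^(s * n + 'C(s.+1, 2)).

Lemma shanks_prodnn (n : nat) : shanks_prod n n = 1.
Proof. by rewrite /shanks_prod big_geq. Qed.

Lemma shanks_prod_recr (s n : nat) : (s <= n)%N ->
  shanks_prod s n.+1 = shanks_prod s n * (1 - 'X^(n.+1)).
Proof. by move=> lesn; rewrite /shanks_prod big_nat_recr. Qed.

Lemma shanks_prod_recl (s n : nat) : (s < n)%N ->
  shanks_prod s n = (1 - 'X^(s.+1)) * shanks_prod s.+1 n.
Proof. by move=> lesn; rewrite /shanks_prod big_ltn. Qed.

(* The difference telescopes: the [s]-th summand splits, according to
   [q^s (1 - q^(n+1)) - 1 = - (1 - q^s) - q^(s+n+1)], into two consecutive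
   values of the same expression. *)
Lemma shanks_sum_recr (n : nat) :
  shanks_sum n.+1 =
  shanks_sum n + (-1) ^+ n.+1 * ('X^(pent_minus n.+1) + 'X^(pent_plus n.+1)).
Proof.
pose t (s : nat) : {poly int} := if s is r.+1 then
  (-1) ^+ s * shanks_prod r n * 'X^(s * n + 'C(s.+1, 2)) else 0.
have diff (s : nat) : (s <= n)%N ->
    (-1) ^+ s * shanks_prod s n.+1 * 'X^(s * n.+1 + 'C(s.+1, 2))
    - (-1) ^+ s * shanks_prod s n * 'X^(s * n + 'C(s.+1, 2)) = t s.+1 - t s.
  move=> lesn; rewrite (shanks_prod_recr lesn) /t.
  have e1 : (s.+1 * n + 'C(s.+2, 2) = s * n + 'C(s.+1, 2) + s + n.+1)%N.
    by rewrite binS bin1; lia.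
  have e2 : (s * n.+1 + 'C(s.+1, 2) = s * n + 'C(s.+1, 2) + s)%N by lia.
  rewrite e1 e2; case: s lesn {e1 e2} => [_|s lesn].
    by rewrite mul0n !add0n bin_small // !expr0 !exprS !expr0; ring.
  rewrite (@shanks_prod_recl s n) // !exprD !exprS; ring.
(* The summand [s = n.+1] produces the exponent [pent_plus n.+1], the telescoped end value [t n.+1]
   the exponent [pent_minus n.+1]. *)
rewrite {1}/shanks_sum big_ord_recr /= shanks_prodnn mulr1.
have -> : \sum_(i < n.+1) (-1) ^+ i * shanks_prod i n.+1 * 'X^(i * n.+1 + 'C(i.+1, 2))
          = shanks_sum n + t n.+1.
  rewrite -[LHS](subrK (shanks_sum n)) addrC; congr (_ + _).
  rewrite /shanks_sum -sumrB.
  under eq_bigr => i _ do rewrite diff -1?ltnS //.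
  rewrite -(big_mkord xpredT (fun i => t i.+1 - t i)) telescope_sumr //.
  by rewrite subr0.
rewrite /t shanks_prodnn mulr1 /pent_minus /pent_plus.
have -> : (n.+1 * n + 'C(n.+2, 2) = n.+1 ^ 2 + 'C(n.+1, 2))%N.
  by rewrite binS bin1; lia.
by rewrite mulnn mulrDr !addrA.
Qed.

Lemma shanks_sumE (n : nat) : shanks_sum n =
  1 + \sum_(1 <= m < n.+1) (-1) ^+ m * ('X^(pent_minus m) + 'X^(pent_plus m)).
Proof.
elim: n => [|n IHn]; last by rewrite shanks_sum_recr IHn [in RHS]big_nat_recr //= addrA.
rewrite /shanks_sum big_ord1 big_geq // shanks_prodnn mul0n add0n bin_small //.
by rewrite !expr0 !mulr1 addr0.
Qed.

Lemma euler_coef_shanks (n : nat) : euler_coef n = (shanks_sum n)`_n.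
Proof.
rewrite /shanks_sum big_ord_recl /= mul0n add0n bin_small // expr0 mul1r mulr1.
rewrite coefD coef_sum big1 ?addr0 // => i _.
rewrite coefMXn ifT // /bump; case: i => i /= _; rewrite -[(1 + i)%N]/i.+1.
by rewrite binS bin1; nia.
Qed.

Lemma coef_signM (m n : nat) (p : {poly int}) :
  ((-1) ^+ m * p)`_n = (-1) ^+ m * p`_n.
Proof. by rewrite -(rmorph_sign polyC) coefCM. Qed.

(** Shanks's identity at level [n] gives the cutoff [m <= n]. Moving it to [M] changes nothing: for
    [m > M] both exponents exceed [pent_plus M >= n], and for [m > n] they are at least m^2 > n. *)
Lemma euler_coefE (n M : nat) : (n <= pent_plus M)%N ->
  euler_coef n = (n == 0%N)%:R + \sum_(1 <= m < M.+1)
    (-1) ^+ m * ((n == pent_minus m)%:R + (n == pent_plus m)%:R).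
Proof.
move=> lenM; rewrite euler_coef_shanks shanks_sumE coefD coef1; congr (_ + _).
rewrite coef_sum.
under eq_bigr => m _ do rewrite coef_signM coefD !coefXn.
pose F (m : nat) : int := (-1) ^+ m * ((n == pent_minus m)%:R + (n == pent_plus m)%:R).
have van (m : nat) : (n < pent_minus m)%N -> (n < pent_plus m)%N -> F m = 0.
  by move=> l1 l2; rewrite /F !ltn_eqF // addr0 mulr0.
have van2 (a b : nat) : (forall m, (a <= m)%N -> F m = 0) -> \sum_(a <= m < b) F m = 0.
  by move=> vanF; rewrite big_nat_cond big1 // => m /andP[/andP[/vanF]].
have [leMn|leMn] := leqP M.+1 n.+1.
  rewrite (big_cat_nat (n := M.+1)) //= [X in _ + X = _]van2 ?addr0 // => m ltMm.
  apply: van; apply: leq_ltn_trans lenM _.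
    exact: pent_minus_gt_plus.
  exact: pent_plus_gt_plus.
rewrite [RHS](big_cat_nat (n := n.+1)) //=; last exact: ltnW.
rewrite [X in _ = _ + X]van2 ?addr0 // => m ltnm.
have lt2 : (n < m ^ 2)%N by nia.
by apply: van; apply: leq_trans lt2 _; rewrite ?pent_minus_ge ?pent_plus_ge.
Qed.

Lemma euler_coef_intrE (R : pzRingType) (n M : nat) : (0 < n <= pent_plus M)%N ->
  (euler_coef n)%:~R = \sum_(1 <= m < M.+1)
    (-1) ^+ m * ((n == pent_minus m)%:R + (n == pent_plus m)%:R) :> R.
Proof.
case/andP=> n_gt0 /euler_coefE ->; rewrite eqn0Ngt n_gt0 add0r rmorph_sum /=; apply: eq_bigr => m _.
by rewrite rmorphM rmorph_sign rmorphD /= !rmorph_nat.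
Qed.

Lemma sum_nat_eq_mul (R : pzRingType) (w : nat -> R) (p P : nat) : (0 < p <= P)%N ->
  \sum_(1 <= n < P.+1) (n == p)%:R * w n = w p.
Proof.
case/andP=> p_gt0 lepP; rewrite (bigD1_seq p) ?iota_uniq ?mem_index_iota ?p_gt0 //=.
rewrite eqxx mul1r big1 ?addr0 // => n /negbTE ->; exact: mul0r.
Qed.

Lemma pent_bounds (m M : nat) : (0 < m <= M)%N ->
  (0 < pent_minus m <= pent_plus M)%N && (0 < pent_plus m <= pent_plus M)%N.
Proof.
case/andP=> m_gt0 lemM; have := pent_plusE m; have := pent_plusE M.
by have := pent_minusE m; nia.
Qed.

(** Cutting at [pent_plus M] keeps both exponents of every [m <= M] and none of a later [m], so the
    two sums agree without remainder. *)
Lemma sum_euler_coef (R : comPzRingType) (w : nat -> R) (M : nat) :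
  \sum_(1 <= n < (pent_plus M).+1) (euler_coef n)%:~R * w n =
  \sum_(1 <= m < M.+1) (-1) ^+ m * (w (pent_minus m) + w (pent_plus m)).
Proof.
under eq_big_nat => n ltnM do rewrite (euler_coef_intrE R ltnM) mulr_suml.
rewrite exchange_big_nat /=; apply: eq_big_nat => m /pent_bounds/andP[bm bp].
under eq_bigr => n _ do rewrite -mulrA mulrDl.
by rewrite -mulr_sumr big_split /= !sum_nat_eq_mul.
Qed.

(** * Absolute convergence of the Dirichlet series *)

Lemma norm_euler_coef_le (R : numDomainType) (n M : nat) : (0 < n <= pent_plus M)%N ->
  `|(euler_coef n)%:~R : R| <=
  \sum_(1 <= m < M.+1) ((n == pent_minus m)%:R + (n == pent_plus m)%:R).
Proof.
move=> hn; rewrite (euler_coef_intrE R hn); apply: le_trans (ler_norm_sum _ _ _) _.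
by apply: ler_sum => m _; rewrite normrM normrX normrN1 expr1n mul1r ger0_norm ?addr_ge0 ?ler0n.
Qed.

Lemma sum_norm_euler_coef_le (R : numFieldType) (w : nat -> R) (M : nat) :
  (forall n, 0 <= w n) ->
  \sum_(1 <= n < (pent_plus M).+1) `|(euler_coef n)%:~R| * w n <=
  \sum_(1 <= m < M.+1) (w (pent_minus m) + w (pent_plus m)).
Proof.
move=> w_ge0.
apply: (@le_trans _ _ (\sum_(1 <= n < (pent_plus M).+1) (\sum_(1 <= m < M.+1)
   ((n == pent_minus m)%:R + (n == pent_plus m)%:R)) * w n)).
  rewrite !big_nat; apply: ler_sum => n ltnM.
  by apply: ler_wpM2r => //; exact: norm_euler_coef_le.
under eq_bigr => n _ do rewrite mulr_suml.
rewrite exchange_big_nat /= !big_nat; apply: ler_sum => m /pent_bounds/andP[bm bp].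
under eq_bigr => n _ do rewrite mulrDl.
by rewrite big_split /= !sum_nat_eq_mul.
Qed.

Lemma sum_inv_sqr_le2 (R : numFieldType) (M : nat) :
  \sum_(1 <= m < M.+1) (m%:R ^+ 2)^-1 <= 2 :> R.
Proof.
case: M => [|M]; first by rewrite big_geq // ler0n.
(* The induction runs on this sharper bound, through 1/(x+1)^2 <= 1/x - 1/(x+1). *)
apply: (@le_trans _ _ (2 - M.+1%:R^-1)); last by rewrite gerBl invr_ge0 ler0n.
elim: M => [|M IHM]; first by rewrite big_nat1 expr1n invr1 -[2]/(1 + 1) addrK.
rewrite big_nat_recr //=; apply: le_trans (lerD IHM (lexx _)) _.
rewrite -addrA lerD2l -subr_ge0.
have: 0 < M.+1%:R :> R by rewrite ltr0n.
rewrite -[M.+2]addn1 natrD; move: (M.+1%:R : R) => x x_gt0.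
have y_gt0 : 0 < x + 1 by rewrite addr_gt0.
have -> : - (x + 1)^-1 - (- x^-1 + ((x + 1) ^+ 2)^-1) = (x * (x + 1) ^+ 2)^-1.
  by field; rewrite (gt_eqF x_gt0) (gt_eqF y_gt0).
by rewrite invr_ge0 mulr_ge0 ?ltW // exprn_gt0.
Qed.

(** Convergence is absolute even for [k = 1]: the support is sparse, and each [m] contributes at
    most 2/m^2, which bounds all partial sums of absolute values by 4. *)
Lemma cvg_sum_euler_coef (R : realType) (k : nat) : (0 < k)%N ->
  cvgn (fun N : nat => \sum_(1 <= n < N) (euler_coef n)%:~R / n%:R ^+ k : R).
Proof.
move=> k_gt0; pose u (n : nat) : R := (euler_coef n)%:~R / n%:R ^+ k.
(* Division by zero returns 0, so the sums may start at [n = 0] and become series. *)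
have u0 : u 0%N = 0 by rewrite /u expr0n gtn_eqF // invr0 mulr0.
have sumu (f : nat -> R) N : f 0%N = 0 -> \sum_(1 <= n < N) f n = \sum_(0 <= n < N) f n.
  by case: N => [|N] f0; [rewrite !big_geq|rewrite [RHS]big_ltn // f0 add0r].
under eq_fun => N do rewrite (sumu u) //.
apply: normed_cvg; rewrite -[X in cvgn X]/(fun N => \sum_(0 <= n < N) `|u n|).
apply: nondecreasing_is_cvgn.
  by apply/nondecreasing_seqP => N; rewrite big_nat_recr //= lerDl.
exists 4 => _ [N _ <-]; rewrite /= -(sumu (fun n => `|u n|)) ?u0 ?normr0 //.
have leN : (N <= (pent_plus N).+1)%N.
  by apply: leq_trans (leqnSn _); apply: leq_trans (pent_plus_ge N); rewrite -mulnn; nia.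
apply: (@le_trans _ _ (\sum_(1 <= n < (pent_plus N).+1) `|u n|)).
  case: N leN => [|N] leN; first by rewrite big_geq // sumr_ge0.
  by rewrite [leRHS](big_cat_nat (n := N.+1)) //= lerDl sumr_ge0.
under eq_bigr => n _ do rewrite normrM.
under eq_bigr => n _ do rewrite [X in _ * X]ger0_norm ?invr_ge0 ?exprn_ge0 ?ler0n //.
apply: le_trans (@sum_norm_euler_coef_le R (fun n => (n%:R ^+ k)^-1) N _) _.
  by move=> n; rewrite invr_ge0 exprn_ge0 ?ler0n.
have lesq (m p : nat) : (0 < m)%N -> (m ^ 2 <= p)%N -> (p%:R ^+ k)^-1 <= (m%:R ^+ 2)^-1 :> R.
  move=> m_gt0 lemp; have p_gt0 : (0 < p)%N by apply: leq_trans lemp; rewrite expn_gt0 m_gt0.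
  rewrite lef_pV2 ?posrE ?exprn_gt0 ?ltr0n // -!natrX ler_nat; apply: leq_trans lemp _.
  by rewrite -[leqLHS]expn1 leq_pexp2l.
have := sum_inv_sqr_le2 R N; set s := \sum_(_ <= _ < _) _ => s2.
apply: (@le_trans _ _ (s + s)); last by lra.
rewrite /s -big_split /= !big_nat; apply: ler_sum => m /andP[m_gt0 _].
by apply: lerD; apply: lesq; rewrite ?pent_minus_ge ?pent_plus_ge.
Qed.

(** * The cosecant as a sum of simple fractions *)

Definition csc_sum (R : unitRingType) (M : nat) (z : R) : R :=
  z^-1 + \sum_(1 <= m < M.+1) (-1) ^+ m * ((z + m%:R)^-1 + (z - m%:R)^-1).

Lemma csc_sumS (R : unitRingType) (M : nat) (z : R) :
  csc_sum M.+1 z =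
  csc_sum M z + (-1) ^+ M.+1 * ((z + M.+1%:R)^-1 + (z - M.+1%:R)^-1).
Proof. by rewrite /csc_sum big_nat_recr //= addrA. Qed.

Lemma csc_sumN (R : fieldType) (M : nat) (z : R) : csc_sum M (- z) = - csc_sum M z.
Proof.
rewrite /csc_sum opprD invrN -sumrN; congr (_ + _); apply: eq_bigr => m _.
have -> : - z + m%:R = - (z - m%:R) by ring.
have -> : - z - m%:R = - (z + m%:R) by ring.
by rewrite !invrN -mulrN opprD addrC.
Qed.

(** The integers of absolute value at most 3M + 1 are exactly 3j, 3j + 1 and 3j - 1 for |j| <= M, so
    sorting by residue mod 3 is exact. Oddness turns the argument (z - 1)/3 into (1 - z)/3. *)
Lemma csc_sum_triple (R : numFieldType) (M : nat) (z : R) :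
  csc_sum (3 * M).+1 z =
  (csc_sum M (z / 3) - csc_sum M ((z + 1) / 3) + csc_sum M ((1 - z) / 3)) / 3.
Proof.
have n3 : (3 : R) != 0 by rewrite pnatr_eq0.
have inv3 (x y : R) : (x / 3 + y)^-1 = 3 * (x + 3 * y)^-1.
  by rewrite -[in RHS](invrK 3) -invfM; congr (_^-1); field.
have invC (x : R) : (1 - z + x)^-1 = - (z - 1 - x)^-1.
  by rewrite -invrN; congr (_^-1); ring.
elim: M => [|M IHM].
  rewrite csc_sumS /csc_sum !big_geq // !addr0 -[X in X / 3]addr0 expr1 !invfM invrK.
  have -> : (1 - z)^-1 = - (z - 1)^-1 by rewrite -invrN opprB.
  by move: (z^-1) ((z + 1)^-1) ((z - 1)^-1) => a b c; field.
rewrite [in RHS]csc_sumS [X in _ - X]csc_sumS [X in _ + X]csc_sumS.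
have -> : ((3 * M.+1).+1 = (3 * M).+4)%N by lia.
rewrite 3!csc_sumS IHM !inv3 !mulrN !invC.
rewrite opprK.
have -> : 3 * M.+1%:R = (3 * M).+2%:R + 1 :> R.
  by rewrite -natrM natr1; congr (_%:R); lia.
rewrite -![(3 * M).+4%:R]natr1 -![(3 * M).+3%:R]natr1.
move: ((3 * M).+2%:R : R) => t.
have -> : z + 1 + (t + 1) = z + (t + 1 + 1) by ring.
have -> : z + 1 - (t + 1) = z - t by ring.
have -> : z - 1 - (t + 1) = z - (t + 1 + 1) by ring.
have -> : z - 1 + (t + 1) = z + t by ring.
rewrite !exprS; have -> : (-1) ^+ (3 * M) = (-1) ^+ M :> R.
  by rewrite -signr_odd oddM /= signr_odd.
move: (_ + _)^-1 (_ - _)^-1 (_ + _)^-1 (_ - _)^-1 (_ + _)^-1 (_ - _)^-1 => a b c d e f.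
by field.
Qed.

(** The triple-angle formula gives 4c^3 - 3c = cos pi = -1 for c = cos(pi/3), that is (c + 1)(2c -
    1)^2 = 0, and c is positive. *)
Lemma cos_pi3 (R : realType) : cos (pi / 3) = 1 / 2 :> R.
Proof.
have pi0 := pi_gt0 R.
have := cosD (pi / 3 *+ 2 : R) (pi / 3).
have -> : pi / 3 *+ 2 + pi / 3 = pi :> R by field.
rewrite cospi cos_mulr2n sin_mulr2n.
have s2 := sin2cos2 (pi / 3 : R).
have c_gt0 : 0 < cos (pi / 3) :> R by apply: cos_gt0_pihalf; apply/andP; split; lra.
move=> h; have : (cos (pi / 3) + 1) * (cos (pi / 3) *+ 2 - 1) ^+ 2 = 0 :> R.
  rewrite -[RHS](addNr 1) {}[in RHS]h; move: s2; move: (sin _) (cos _) => s c s2.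
  by rewrite -mulrnAl mulrAC -mulrA -(expr2 s) s2; ring.
move/eqP; rewrite mulf_eq0 expf_eq0 /= => /orP[/eqP|/eqP]; lra.
Qed.

Lemma sin_pi3_gt0 (R : realType) : 0 < sin (pi / 3) :> R.
Proof. by have pi0 := pi_gt0 R; apply: sin_gt0_pi; apply/andP; split; lra. Qed.

Lemma sin_pi3_sqr (R : realType) : sin (pi / 3) ^+ 2 = 3 / 4 :> R.
Proof. by rewrite sin2cos2 cos_pi3; field. Qed.

Lemma sin_pi3 (R : realType) : sin (pi / 3) = Num.sqrt 3 / 2 :> R.
Proof.
apply/eqP; rewrite -(eqrXn2 (n := 2)) // ?divr_ge0 ?sqrtr_ge0 ?ltW ?sin_pi3_gt0 //.
by rewrite sin_pi3_sqr expr_div_n sqr_sqrtr ?ler0n // -natrX.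
Qed.

Lemma sin_triple (R : realType) (w : R) : sin (3 * w) = 3 * sin w - 4 * sin w ^+ 3.
Proof.
have -> : 3 * w = w *+ 2 + w by ring.
rewrite sinD sin_mulr2n cos_mulr2n.
transitivity (cos w ^+ 2 * sin w *+ 4 - sin w); first by ring.
by rewrite cos2sin2; ring.
Qed.

(* [sin (3 w) = 4 sin w sin (pi/3 - w) sin (pi/3 + w)] *)
Lemma csc_triple (R : realType) (w : R) :
  sin w != 0 -> sin (pi / 3 + w) != 0 -> sin (pi / 3 - w) != 0 ->
  (sin (3 * w))^-1 = ((sin w)^-1 - (sin (pi / 3 + w))^-1 + (sin (pi / 3 - w))^-1) / 3.
Proof.
move=> s0 sp sm.
have prod : sin (pi / 3 + w) * sin (pi / 3 - w) = 3 / 4 - sin w ^+ 2.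
  by rewrite sinD sinB mulrC -subr_sqr !exprMn sin_pi3_sqr cos_pi3 cos2sin2; field.
have diff : sin (pi / 3 + w) - sin (pi / 3 - w) = sin w.
  by rewrite sinD sinB cos_pi3; field.
have -> : sin (3 * w) = 4 * sin w * (sin (pi / 3 + w) * sin (pi / 3 - w)).
  by rewrite prod sin_triple; field.
have -> : (sin w)^-1 - (sin (pi / 3 + w))^-1 + (sin (pi / 3 - w))^-1 =
    (sin (pi / 3 + w) * sin (pi / 3 - w) + sin w * (sin (pi / 3 + w) - sin (pi / 3 - w)))
     / (sin w * (sin (pi / 3 + w) * sin (pi / 3 - w))).
  by field; rewrite s0 sp sm.
rewrite diff prod -(expr2 (sin w)) subrK -prod.
by field; rewrite s0 sp sm.
Qed.

(** * Elementary bounds for the sine and its reciprocal *)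

Section SineBounds.
Variable R : realType.
Implicit Types x y : R.

Lemma sin_mvt x : 0 <= x -> exists2 c, 0 <= c <= x & sin x = x * cos c.
Proof.
move=> x0.
have dP y : y \in `]0, x[ -> is_derive y 1 sin (cos y) by move=> _; exact: is_derive_sin.
have cP : {within `[0, x], continuous (@sin R)}.
  by apply: derivable_within_continuous => y _; exact: derivable_sin.
have [c] := MVT_segment x0 dP cP.
by rewrite in_itv /= sin0 !subr0 => hc e; exists c => //; rewrite e mulrC.
Qed.

Lemma sin_le_id x : 0 <= x -> sin x <= x.
Proof.
by move=> x0; have [c _ ->] := sin_mvt x0; rewrite ler_piMr // cos_le1.
Qed.

Lemma cos_ge_quadratic x : 0 <= x <= pi -> 1 - x ^+ 2 / 2 <= cos x.
Proof.
case/andP=> x0 xpi.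
have -> : cos x = 1 - sin (x / 2) ^+ 2 *+ 2.
  by rewrite -[in LHS](divfK (_ : 2 != 0 :> R) x) ?pnatr_eq0 // mulr_natr cos_mulr2n cos2sin2; ring.
have h : sin (x / 2) <= x / 2 by apply: sin_le_id; lra.
have h0 : 0 <= sin (x / 2) by apply: sin_ge0_pi; apply/andP; split; lra.
by have : sin (x / 2) ^+ 2 <= (x / 2) ^+ 2 by [rewrite lerXn2r ?nnegrE //; lra]; nra.
Qed.

Lemma sin_ge_cubic x : 0 <= x <= pi -> x - x ^+ 3 / 2 <= sin x.
Proof.
case/andP=> x0 xpi; have [c /andP[c0 cx] ->] := sin_mvt x0.
have : 1 - c ^+ 2 / 2 <= cos c by apply: cos_ge_quadratic; rewrite c0 (le_trans cx).
have : c ^+ 2 <= x ^+ 2 by rewrite lerXn2r ?nnegrE.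
rewrite (exprS x 2) => h1 h2.
have : x * (1 - x ^+ 2 / 2) <= x * cos c by apply: ler_wpM2l => //; lra.
by lra.
Qed.

(** Halving the angle gives sin x = x cos c cos(x/2) with c <= x/2, and cos c cos(x/2) >= cos(x/2)^2
    = (1 + cos x)/2 >= 1/2. *)
Lemma sin_ge_half x : 0 <= x <= pi / 2 -> x / 2 <= sin x.
Proof.
case/andP=> x0 xpi; have pi0 := pi_gt0 R.
have [c /andP[c0 cx] e] := @sin_mvt (x / 2) ltac:(lra).
have -> : sin x = x * (cos c * cos (x / 2)).
  by rewrite -[in LHS](divfK (_ : 2 != 0 :> R) x) ?pnatr_eq0 // mulr_natr sin_mulr2n e; field.
have cosx : 0 <= cos x by apply: cos_ge0_pihalf; apply/andP; split; lra.
have cosh : 0 <= cos (x / 2) by apply: cos_ge0_pihalf; apply/andP; split; lra.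
have : cos (x / 2) <= cos c.
  move: cx; rewrite le_eqVlt => /orP[/eqP -> //|cx].
  by apply: ltW; rewrite ltr_cos // in_itv /=; apply/andP; split; lra.
have : cos x = cos (x / 2) ^+ 2 *+ 2 - 1.
  by rewrite -[in LHS](divfK (_ : 2 != 0 :> R) x) ?pnatr_eq0 // mulr_natr cos_mulr2n.
move=> e2 le1; have le2 : cos (x / 2) * cos (x / 2) <= cos c * cos (x / 2) by exact: ler_wpM2r.
have : x * (1 / 2) <= x * (cos c * cos (x / 2)); last by lra.
by apply: ler_wpM2l => //; rewrite expr2 in e2; lra.
Qed.

(** The difference is (x - sin x)/(x sin x), at most (x^3/2)/(x^2/2) = x, and x <= pi/2 < 2. *)
Lemma csc_sub_inv_bound x : 0 < x <= pi / 2 -> `|(sin x)^-1 - x^-1| <= 2.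
Proof.
case/andP=> x0 xpi; have p2 := pihalf_lt2 R.
have xs : 0 <= x <= pi by apply/andP; split; have := pi_gt0 R; lra.
have := sin_ge_half (x := x); rewrite (ltW x0) xpi => /(_ isT) s_ge.
have s_gt0 : 0 < sin x by lra.
have -> : (sin x)^-1 - x^-1 = (x - sin x) / (x * sin x).
  by field; rewrite !gt_eqF.
rewrite ger0_norm; last by rewrite divr_ge0 ?mulr_ge0 ?subr_ge0 ?sin_le_id // ltW.
rewrite ler_pdivrMr ?mulr_gt0 //; have := sin_ge_cubic xs.
have h : x * (x / 2) <= x * sin x by rewrite ler_pM2l.
have h2 : x ^+ 3 <= 2 * x ^+ 2 by rewrite exprS; apply: ler_wpM2r; [exact: sqr_ge0|lra].
by rewrite expr2 in h2; lra.
Qed.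

(** The derivative is (sin^2 c - c^2 cos c)/(c^2 sin^2 c), whose numerator is at most c^4 in
    absolute value and whose denominator is at least c^4/4. *)
Lemma csc_sub_inv_lipschitz x y : 0 < x <= pi / 2 -> 0 < y <= pi / 2 ->
  `|((sin x)^-1 - x^-1) - ((sin y)^-1 - y^-1)| <= 4 * `|x - y|.
Proof.
wlog lexy : x y / x <= y => [wlg hx hy|].
  by have [/wlg->//|/ltW/wlg] := leP x y; rewrite distrC (distrC x); exact.
case/andP=> x0 _ /andP[y0 ypi]; have pi0 := pi_gt0 R.
pose dq (t : R) := - (sin t) ^- 2 * cos t - - t ^- 2.
have dqP t : x <= t <= y -> is_derive t 1 (fun t => (sin t)^-1 - t^-1) (dq t).
  case/andP=> xt ty; have t0 : t != 0 by rewrite gt_eqF // (lt_le_trans x0).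
  have s0 : sin t != 0 by rewrite gt_eqF // sin_gt0_pi //; apply/andP; split; lra.
  have d1 : is_derive t 1 (fun t => (sin t)^-1) (- (sin t) ^- 2 *: cos t).
    by apply: is_deriveV.
  have d2 : is_derive t 1 (fun t : R => t^-1) (- t ^- 2 *: 1) by apply: is_deriveV.
  apply: is_derive_eq; rewrite /dq; congr (_ - _).
  by rewrite -[LHS]/(- t ^- 2 * 1) mulr1.
have dP t : t \in `]x, y[ -> is_derive t 1 (fun t => (sin t)^-1 - t^-1) (dq t).
  by rewrite in_itv /= => /andP[? ?]; apply: dqP; rewrite !ltW.
have cP : {within `[x, y], continuous (fun t : R => (sin t)^-1 - t^-1)}.
  apply: derivable_within_continuous => t; rewrite in_itv /= => ht.
  by have [] := dqP t ht.
have [c] := MVT_segment lexy dP cP.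
rewrite in_itv /= => /andP[xc cy] e; rewrite distrC e normrM (distrC x).
apply: ler_wpM2r => //.
have c0 : 0 < c by lra.
have hc : 0 <= c <= pi by apply/andP; split; lra.
have := @sin_ge_half c; rewrite (ltW c0) (le_trans cy ypi) => /(_ isT) s_ge.
have s_gt0 : 0 < sin c by lra.
have -> : dq c = (sin c ^+ 2 - c ^+ 2 * cos c) / (c ^+ 2 * sin c ^+ 2).
  by rewrite /dq; field; rewrite !gt_eqF.
rewrite normrM normfV [X in _ / X]ger0_norm; last by apply: mulr_ge0; exact: sqr_ge0.
rewrite ler_pdivrMr ?mulr_gt0 ?exprn_gt0 //.
have s2 : (c / 2) ^+ 2 <= sin c ^+ 2 by rewrite lerXn2r ?nnegrE // ltW ?divr_gt0.
have s2u : sin c ^+ 2 <= c ^+ 2 by rewrite lerXn2r ?nnegrE ?sin_le_id ?ltW.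
have c2 : 0 <= c ^+ 2 by exact: sqr_ge0.
have h4 : c ^+ 2 * c ^+ 2 <= 4 * (c ^+ 2 * sin c ^+ 2).
  by have : c ^+ 2 * (c / 2) ^+ 2 <= c ^+ 2 * sin c ^+ 2 by [exact: ler_wpM2l]; lra.
have hcos : c ^+ 2 * (1 - c ^+ 2 / 2) <= c ^+ 2 * cos c.
  by apply: ler_wpM2l => //; exact: cos_ge_quadratic.
have hcos1 : c ^+ 2 * cos c <= c ^+ 2 by rewrite ler_piMr // cos_le1.
have hs : c ^+ 2 - sin c ^+ 2 <= c ^+ 2 * c ^+ 2.
  rewrite subr_sqr; have -> : c ^+ 2 * c ^+ 2 = (c ^+ 3 / 2) * (c + c) by field.
  have h1 := sin_ge_cubic hc; have h2 := sin_le_id (ltW c0).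
  by apply: ler_pM; lra.
by apply: (le_trans _ h4); rewrite ler_norml; apply/andP; split; lra.
Qed.

End SineBounds.

(** The number (3^n - 1)/2, written with [n] ternary digits 1: the truncation orders linked by
    [csc_sum_triple]. *)
Definition repunit3 (n : nat) : nat := iter n (fun M => (3 * M).+1) 0%N.

(** * The error of the symmetric partial sums *)

Section CosecantSeries.
Variable R : realType.
Implicit Types x y z : R.

Definition csc_err (M : nat) z : R := pi / sin (pi * z) - csc_sum M z.

(** The cosecant and its partial sums obey the same tripling formula. All three new arguments lie
    again in (0, 1/2], so the formula can be iterated. *)
Lemma csc_err_triple (M : nat) z : 0 < z <= 1 / 2 ->
  csc_err (3 * M).+1 z =
  (csc_err M (z / 3) - csc_err M ((z + 1) / 3) + csc_err M ((1 - z) / 3)) / 3.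
Proof.
case/andP=> z0 z2; have pi0 := pi_gt0 R.
have s_neq0 (t : R) : 0 < t < 1 -> sin (pi * t) != 0.
  case/andP=> t0 t1; rewrite gt_eqF // sin_gt0_pi // mulr_gt0 //=.
  by rewrite -[ltRHS]mulr1 ltr_pM2l.
have s1 : sin (pi * (z / 3)) != 0 by apply: s_neq0; apply/andP; split; lra.
have s2 : sin (pi * ((z + 1) / 3)) != 0 by apply: s_neq0; apply/andP; split; lra.
have s3 : sin (pi * ((1 - z) / 3)) != 0 by apply: s_neq0; apply/andP; split; lra.
have e2 : pi * ((z + 1) / 3) = pi / 3 + pi * (z / 3) by field.
have e3 : pi * ((1 - z) / 3) = pi / 3 - pi * (z / 3) by field.
rewrite /csc_err csc_sum_triple.
have -> : pi * z = 3 * (pi * (z / 3)) by field.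
rewrite e2 e3 in s2 s3 *; rewrite csc_triple //.
move: (sin _)^-1 (sin _)^-1 (sin _)^-1 => a b c; by field.
Qed.

Lemma csc_err0E x : csc_err 0 x = pi * ((sin (pi * x))^-1 - (pi * x)^-1).
Proof.
rewrite /csc_err /csc_sum big_geq // addr0 mulrBr invfM; congr (_ - _).
by rewrite mulrA mulfV ?mul1r // gt_eqF // pi_gt0.
Qed.

Lemma csc_err0_lipschitz x y : 0 < x <= 1 / 2 -> 0 < y <= 1 / 2 ->
  `|csc_err 0 x - csc_err 0 y| <= 4 * pi ^+ 2 * `|x - y|.
Proof.
have pi0 := pi_gt0 R.
have half (t : R) : 0 < t <= 1 / 2 -> 0 < pi * t <= pi / 2.
  case/andP=> t0 t2; rewrite mulr_gt0 //=.
  by have := ler_wpM2l (ltW pi0) t2; lra.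
move=> /half hx /half hy; have := csc_sub_inv_lipschitz hx hy.
rewrite !csc_err0E -!mulrBr !normrM (gtr0_norm pi0) => h.
by have := ler_wpM2l (ltW pi0) h; rewrite expr2; lra.
Qed.

Lemma csc_err0_bound x : 0 < x <= 1 / 2 -> `|csc_err 0 x| <= 2 * pi.
Proof.
case/andP=> x0 x2; have pi0 := pi_gt0 R.
have : 0 < pi * x <= pi / 2.
  by rewrite mulr_gt0 //=; have := ler_wpM2l (ltW pi0) x2; lra.
move/csc_sub_inv_bound; rewrite csc_err0E => h.
by rewrite normrM (gtr0_norm pi0) mulrC ler_wpM2r // ltW.
Qed.

(* Each tripling step averages three values at points with one third of the
   spacing, hence divides the Lipschitz constant by three. *)
Lemma csc_err_lipschitz (n : nat) x y : 0 < x <= 1 / 2 -> 0 < y <= 1 / 2 ->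
  `|csc_err (repunit3 n) x - csc_err (repunit3 n) y|
  <= 4 * pi ^+ 2 / 3 ^+ n * `|x - y|.
Proof.
elim: n x y => [|n IHn] x y hx hy; first by rewrite expr0 divr1 csc_err0_lipschitz.
rewrite /repunit3 iterS -/(repunit3 n) !csc_err_triple //.
case/andP: hx => x0 x2; case/andP: hy => y0 y2.
have h1 := IHn (x / 3) (y / 3) ltac:(lra) ltac:(lra).
have h2 := IHn ((x + 1) / 3) ((y + 1) / 3) ltac:(lra) ltac:(lra).
have h3 := IHn ((1 - x) / 3) ((1 - y) / 3) ltac:(lra) ltac:(lra).
move: h1 h2 h3.
have -> : x / 3 - y / 3 = (x - y) / 3 by field.
have -> : (x + 1) / 3 - (y + 1) / 3 = (x - y) / 3 by field.
have -> : (1 - x) / 3 - (1 - y) / 3 = - ((x - y) / 3) by field.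
rewrite normrN normrM [`|3^-1|]ger0_norm ?invr_ge0 ?ler0n // [3 ^+ n.+1]exprS invfM.
move: (csc_err _ _) (csc_err _ _) (csc_err _ _) (csc_err _ _) (csc_err _ _) (csc_err _ _).
move=> a1 b1 a2 b2 a3 b3.
have -> : 4 * pi ^+ 2 * (3^-1 / 3 ^+ n) * `|x - y| = 4 * pi ^+ 2 / 3 ^+ n * (`|x - y| / 3) by ring.
move: (_ * (`|x - y| / 3)) => L.
rewrite !ler_norml => /andP[? ?] /andP[? ?] /andP[? ?]; apply/andP; split; lra.
Qed.

(** In the tripling formula the first value is bounded by induction, and the other two enter as a
    difference, bounded by the Lipschitz constant 4 pi^2/3^n. Their sum is then divided by 3; the
    ratio 2/3 leaves room to absorb the Lipschitz term. *)
Lemma csc_err_bound (n : nat) x : 0 < x <= 1 / 2 ->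
  `|csc_err (repunit3 n) x| <= (2 * pi + 4 * pi ^+ 2) * (2 / 3) ^+ n.
Proof.
have pi0 := pi_gt0 R; have pi2 : 0 < pi ^+ 2 :> R by rewrite exprn_gt0.
elim: n x => [|n IHn] x hx.
  by rewrite expr0 mulr1; have := csc_err0_bound hx; lra.
rewrite /repunit3 iterS -/(repunit3 n) !csc_err_triple //.
case/andP: hx => x0 x2.
have h1 := IHn (x / 3) ltac:(lra).
have h2 := @csc_err_lipschitz n ((1 - x) / 3) ((x + 1) / 3) ltac:(lra) ltac:(lra).
have h3 : `|(1 - x) / 3 - (x + 1) / 3| <= 1.
  by rewrite ler_norml; apply/andP; split; lra.
have h4 : 4 * pi ^+ 2 / 3 ^+ n <= 4 * pi ^+ 2 * (2 / 3) ^+ n :> R.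
  apply: ler_wpM2l; first by lra.
  by rewrite -exprVn lerXn2r ?nnegrE //; lra.
have h5 : 0 <= 4 * pi ^+ 2 / 3 ^+ n :> R by rewrite divr_ge0 ?exprn_ge0 //; lra.
have h6 := ler_wpM2l h5 h3; have h7 := le_trans (le_trans h2 h6) (_ : _ <= 4 * pi ^+ 2 * (2 / 3) ^+ n).
rewrite mulr1 in h7; move: {h7}(h7 h4) h1; rewrite [(2 / 3) ^+ n.+1]exprS.
have p1 : 0 <= pi * (2 / 3) ^+ n :> R by rewrite mulr_ge0 ?exprn_ge0 ?ltW //; lra.
move: p1; move: ((2 / 3) ^+ n : R) (pi ^+ 2 : R) (csc_err _ _) (csc_err _ _) (csc_err _ _).
move=> q P a b c p1.
rewrite !ler_norml => /andP[? ?] /andP[? ?]; apply/andP; split; lra.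
Qed.

Lemma cvg_geometric_bound (u : nat -> R) (l C q : R) : 0 <= q < 1 ->
  (forall n, `|u n - l| <= C * q ^+ n) -> u @ \oo --> l.
Proof.
case/andP=> q0 q1 hu; apply/subr_cvg0/norm_cvg0P.
apply: (@squeeze_cvgr _ _ _ _ (cst 0) (geometric C q)).
- by apply: nearW => n /=; rewrite normr_ge0 hu.
- exact: cvg_cst.
- by apply: cvg_geometric; rewrite ger0_norm.
Qed.

Lemma cvg_csc_sum z : 0 < `|z| <= 1 / 2 ->
  (fun n => csc_sum (repunit3 n) z) @ \oo --> pi / sin (pi * z).
Proof.
wlog z0 : z / 0 < z => [wlg hz|].
  have [|z0|z0] := ltgtP 0 z; first by move=> /wlg; exact.
    have := wlg (- z); rewrite oppr_gt0 normrN => /(_ z0 hz) /cvgN.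
    rewrite mulrN sinN invrN mulrN opprK.
    rewrite (_ : - _ = fun n => csc_sum (repunit3 n) z) //.
    by apply/funext => n; rewrite -[LHS]/(- csc_sum (repunit3 n) (- z)) csc_sumN opprK.
  by move: hz; rewrite -z0 normr0 ltxx.
rewrite (gtr0_norm z0) => hz.
apply: (@cvg_geometric_bound _ _ (2 * pi + 4 * pi ^+ 2) (2 / 3)); first by apply/andP; split; lra.
by move=> n; rewrite distrC; exact: csc_err_bound.
Qed.

End CosecantSeries.

(** * Asymptotic expansions at 0 *)

Section AsymptoticExpansions.
Variable R : realType.
Implicit Types (c d : nat -> R) (f g : R -> R) (p : {poly R}) (n : nat).

(** Asymptotic expansions, unlike convergent power series, pass to products and quotients by plain
    estimates, yet still determine their coefficients. The punctured neighbourhood ignores the value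
    at a removable singularity. *)
Definition expands_upto c f n : Prop :=
  exists C : R, \forall x \near 0^', `|f x - (\poly_(i < n) c i).[x]| <= C * `|x| ^+ n.

Definition has_expansion c f : Prop := forall n, expands_upto c f n.

Definition cauchy_prod c d n : R := \sum_(i < n.+1) c i * d (n - i)%N.

Lemma horner_bounded p : exists C : R, \forall x \near 0^', `|p.[x]| <= C.
Proof.
exists (\sum_(i < size p) `|p`_i|); near=> x.
have x1 : `|x| <= 1 by near: x; exact: dnbhs0_le.
rewrite horner_coef; apply: le_trans (ler_norm_sum _ _ _) _.
apply: ler_sum => i _; rewrite normrM normrX ler_piMr //.
by rewrite exprn_ile1.
Unshelve. all: by end_near. Qed.

(** The part of [p] of degree at least [n] is [x ^+ n] times a polynomial bounded near 0, so it is
    absorbed by the remainder. *)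
Lemma expands_upto_poly c f n p : (forall i, (i < n)%N -> p`_i = c i) ->
  (exists C : R, \forall x \near 0^', `|f x - p.[x]| <= C * `|x| ^+ n) ->
  expands_upto c f n.
Proof.
move=> pc [C hC]; have [D hD] := horner_bounded (drop_poly n p).
exists (C + D); near=> x.
have -> : \poly_(i < n) c i = take_poly n p.
  by apply/polyP => i; rewrite coef_poly coef_take_poly; case: ifP => // /pc.
have hCx : `|f x - p.[x]| <= C * `|x| ^+ n by near: x.
have hDx : `|(drop_poly n p).[x]| <= D by near: x.
have -> : f x - (take_poly n p).[x] = (f x - p.[x]) + (drop_poly n p).[x] * x ^+ n.
  by rewrite -[in p.[x]](poly_take_drop n p) !hornerE; ring.
apply: le_trans (ler_normD _ _) _; rewrite mulrDl lerD // normrM normrX.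
by rewrite ler_wpM2r.
Unshelve. all: by end_near. Qed.

Lemma has_expansion_bounded c f : has_expansion c f ->
  exists C : R, \forall x \near 0^', `|f x| <= C.
Proof.
move=> /(_ 0%N) [C hC]; exists C; near=> x.
have : `|f x - (\poly_(i < 0) c i).[x]| <= C * `|x| ^+ 0 by near: x.
by rewrite horner_poly big_ord0 subr0 expr0 mulr1.
Unshelve. all: by end_near. Qed.

Lemma has_expansion_horner p : has_expansion (fun i => p`_i) (horner p).
Proof.
move=> n; apply: (@expands_upto_poly _ _ _ p) => //; exists 0; near=> x.
by rewrite subrr normr0 mul0r.
Unshelve. all: by end_near. Qed.

Lemma eq_has_expansion c d f g : c =1 d -> (\forall x \near 0^', f x = g x) ->
  has_expansion c f -> has_expansion d g.
Proof.
move=> cd fg h n; have [C hC] := h n; exists C; near=> x.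
have <- : f x = g x by near: x.
have -> : \poly_(i < n) d i = \poly_(i < n) c i.
  by apply/polyP => i; rewrite !coef_poly cd.
by near: x.
Unshelve. all: by end_near. Qed.

Lemma has_expansionD c d f g : has_expansion c f -> has_expansion d g ->
  has_expansion (fun i => c i + d i) (fun x => f x + g x).
Proof.
move=> hf hg n; have [C hC] := hf n; have [D hD] := hg n; exists (C + D); near=> x.
have hCx : `|f x - (\poly_(i < n) c i).[x]| <= C * `|x| ^+ n by near: x.
have hDx : `|g x - (\poly_(i < n) d i).[x]| <= D * `|x| ^+ n by near: x.
have -> : \poly_(i < n) (c i + d i) = \poly_(i < n) c i + \poly_(i < n) d i.
  by apply/polyP => i; rewrite coefD !coef_poly; case: ifP => // _; rewrite addr0.
rewrite hornerD opprD addrACA mulrDl; apply: le_trans (ler_normD _ _) _; exact: lerD.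
Unshelve. all: by end_near. Qed.

Lemma has_expansionZ (a : R) c f : has_expansion c f ->
  has_expansion (fun i => a * c i) (fun x => a * f x).
Proof.
move=> hf n; have [C hC] := hf n; exists (`|a| * C); near=> x.
have -> : \poly_(i < n) (a * c i) = a *: \poly_(i < n) c i.
  by apply/polyP => i; rewrite coefZ !coef_poly; case: ifP => // _; rewrite mulr0.
rewrite hornerZ -mulrBr normrM -mulrA ler_wpM2l //.
by near: x.
Unshelve. all: by end_near. Qed.

Lemma dnbhs0_scale (a : R) (P : R -> Prop) : a != 0 ->
  (\forall x \near 0^', P x) -> \forall x \near 0^', P (a * x).
Proof.
move=> a0 [e /= e0 he]; exists (e / `|a|) => /=; first by rewrite divr_gt0 // normr_gt0.
move=> x /=; rewrite sub0r normrN => hx x0; apply: he.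
  by rewrite /= sub0r normrN normrM mulrC -ltr_pdivlMr // normr_gt0.
by rewrite mulf_neq0.
Qed.

Lemma has_expansion_scale (a : R) c f : a != 0 -> has_expansion c f ->
  has_expansion (fun i => c i * a ^+ i) (fun x => f (a * x)).
Proof.
move=> a0 hf n; have [C /(dnbhs0_scale a0) hC] := hf n; exists (C * `|a| ^+ n); near=> x.
have -> : (\poly_(i < n) (c i * a ^+ i)).[x] = (\poly_(i < n) c i).[a * x].
  by rewrite !horner_poly; apply: eq_bigr => i _; rewrite exprMn mulrA.
by rewrite -mulrA -exprMn -normrM; near: x.
Unshelve. all: by end_near. Qed.

Lemma has_expansionM c d f g : has_expansion c f -> has_expansion d g ->
  has_expansion (cauchy_prod c d) (fun x => f x * g x).
Proof.
move=> hf hg n; pose p := \poly_(i < n) c i; pose q := \poly_(i < n) d i.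
apply: (@expands_upto_poly _ _ _ (p * q)).
  move=> i ltin; rewrite coefM; apply: eq_bigr => j _; rewrite !coef_poly.
  by rewrite (leq_ltn_trans _ ltin) ?leq_ord // (leq_ltn_trans _ ltin) // leq_subr.
have [C hC] := hf n; have [D hD] := hg n.
have [A hA] := has_expansion_bounded hg; have [B hB] := horner_bounded p.
exists (C * A + B * D); near=> x.
have hCx : `|f x - p.[x]| <= C * `|x| ^+ n by near: x.
have hDx : `|g x - q.[x]| <= D * `|x| ^+ n by near: x.
have hAx : `|g x| <= A by near: x.
have hBx : `|p.[x]| <= B by near: x.
rewrite hornerM.
have -> : f x * g x - p.[x] * q.[x] = (f x - p.[x]) * g x + p.[x] * (g x - q.[x]) by ring.
apply: le_trans (ler_normD _ _) _; rewrite !normrM mulrDl mulrAC -(mulrA B).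
by apply: lerD; apply: ler_pM.
Unshelve. all: by end_near. Qed.

(** At the first index where the coefficients could differ, the two remainders give
    [|c n - d n| <= (C + D) * |x|], and x tends to 0. *)
Lemma has_expansion_unique c d f : has_expansion c f -> has_expansion d f -> c =1 d.
Proof.
move=> hc hd; apply: ltn_ind => n IHn.
have [C hC] := hc n.+1; have [D hD] := hd n.+1.
apply/eqP; rewrite -subr_eq0; apply/negPn/negP => ne0.
have e0 : 0 < `|c n - d n| by rewrite normr_gt0.
have key : \forall x \near (0 : R)^', `|c n - d n| <= (C + D) * `|x|.
  near=> x.
  have hCx : `|f x - (\poly_(i < n.+1) c i).[x]| <= C * `|x| ^+ n.+1 by near: x.
  have hDx : `|f x - (\poly_(i < n.+1) d i).[x]| <= D * `|x| ^+ n.+1 by near: x.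
  have x0 : 0 < `|x| by rewrite normr_gt0; near: x; exact: nbhs_dnbhs_neq.
  rewrite -(ler_pM2r (exprn_gt0 n x0)) -mulrA -exprS mulrDl.
  apply: le_trans (lerD hCx hDx); rewrite -[X in _ <= X + _]normrN.
  apply: le_trans (ler_normD _ _).
  rewrite -normrX -normrM !horner_poly !big_ord_recr /=.
  have -> : \sum_(i < n) c i * x ^+ i = \sum_(i < n) d i * x ^+ i.
    by apply: eq_bigr => i _; rewrite IHn.
  by rewrite le_eqVlt; apply/orP; left; apply/eqP; congr `|_|; ring.
have : \forall x \near (0 : R)^', False.
  near=> x.
  have h : `|c n - d n| <= (C + D) * `|x| by near: x.
  have hx : `|x| < `|c n - d n| / (`|C + D| + 1).
    by near: x; apply: dnbhs0_lt; rewrite divr_gt0 // ltr_wpDl.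
  move: hx; rewrite ltr_pdivlMr ?ltr_wpDl // => hx.
  have : (C + D) * `|x| <= `|C + D| * `|x| by rewrite ler_wpM2r // ler_norm.
  have := normr_ge0 x; lra.
by move/filter_ex => [].
Unshelve. all: by end_near. Qed.

Lemma has_expansion_shift c f : has_expansion c f ->
  has_expansion (fun i => c i.+1) (fun x => (f x - c 0%N) / x).
Proof.
move=> hf n; have [C hC] := hf n.+1; exists C; near=> x.
have x0 : x != 0 by near: x; exact: nbhs_dnbhs_neq.
have hCx : `|f x - (\poly_(i < n.+1) c i).[x]| <= C * `|x| ^+ n.+1 by near: x.
rewrite -(@ler_pM2r _ `|x|) ?normr_gt0 // -mulrA -exprSr -normrM mulrBl divfK //.
apply: le_trans hCx; rewrite !horner_poly big_ord_recl /= expr0 mulr1 mulr_suml.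
rewrite opprD addrA le_eqVlt; apply/orP; left; apply/eqP; congr `|_ - _|.
by apply: eq_bigr => i _; rewrite /bump /= -mulrA -exprSr.
Unshelve. all: by end_near. Qed.

(** No series is inverted: the coefficients of the quotient are supplied and checked by
    multiplication. Dividing by [f], of size at least [k * |x|], costs one order, hence the
    truncation at [n.+1]. *)
Lemma has_expansion_div c d s f g (k : R) : cauchy_prod c s =1 d -> 0 < k ->
  has_expansion s f -> has_expansion d g ->
  (\forall x \near 0^', k * `|x| <= `|f x|) -> has_expansion c (fun x => g x / f x).
Proof.
move=> csd k0 hs hd hk n; pose p := \poly_(i < n.+1) c i.
apply: (@expands_upto_poly _ _ _ p).
  by move=> i ltin; rewrite coef_poly (ltn_trans ltin).
have [C hC] := has_expansionM (has_expansion_horner p) hs n.+1; have [D hD] := hd n.+1.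
have pol : \poly_(i < n.+1) cauchy_prod (fun i => p`_i) s i = \poly_(i < n.+1) d i.
  apply/polyP => i; rewrite !coef_poly; case: ifP => // ltin; rewrite -csd.
  apply: eq_bigr => j _; rewrite coef_poly (leq_ltn_trans _ ltin) //.
  by rewrite leq_ord.
exists ((C + D) / k); near=> x.
have hCx : `|p.[x] * f x - (\poly_(i < n.+1) cauchy_prod (fun i => p`_i) s i).[x]|
    <= C * `|x| ^+ n.+1 by near: x.
have hDx : `|g x - (\poly_(i < n.+1) d i).[x]| <= D * `|x| ^+ n.+1 by near: x.
have hkx : k * `|x| <= `|f x| by near: x.
have x0 : 0 < `|x| by rewrite normr_gt0; near: x; exact: nbhs_dnbhs_neq.
have f0 : 0 < `|f x| by apply: lt_le_trans hkx; exact: mulr_gt0.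
have fx0 : f x != 0 by rewrite -normr_gt0.
have -> : g x / f x - p.[x] = (g x - p.[x] * f x) / f x by field.
rewrite normrM normfV ler_pdivrMr //.
have le1 : `|g x - p.[x] * f x| <= (C + D) * `|x| ^+ n.+1.
  rewrite mulrDl; apply: le_trans (lerD hCx hDx).
  rewrite -[X in _ <= X + _]normrN; apply: le_trans (ler_normD _ _).
  by rewrite pol le_eqVlt; apply/orP; left; apply/eqP; congr `|_|; ring.
have CD0 : 0 <= C + D.
  by rewrite -(pmulr_lge0 _ (exprn_gt0 n.+1 x0)); exact: le_trans le1.
apply: (le_trans le1).
have -> : (C + D) * `|x| ^+ n.+1 = (C + D) / k * `|x| ^+ n * (k * `|x|).
  by rewrite exprSr; field; rewrite gt_eqF.
by rewrite ler_wpM2l // mulr_ge0 ?divr_ge0 ?exprn_ge0 // ltW.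
Unshelve. all: by end_near. Qed.

(** Convergence at one point a > 0 bounds all [|c i| * a ^+ i]; for |x| <= a/2 the tail is then
    dominated by a geometric series of ratio at most 1/2. *)
Lemma power_series_expansion c f :
  (\forall x \near 0^', (fun N : nat => \sum_(0 <= i < N) c i * x ^+ i) @ \oo --> f x) ->
  has_expansion c f.
Proof.
move=> cvgf.
have [a [a0 cvga]] : exists a : R, 0 < a /\
    (fun N : nat => \sum_(0 <= i < N) c i * a ^+ i) @ \oo --> f a.
  case: cvgf => e /= e0 he; exists (e / 2); split; first by rewrite divr_gt0.
  apply: he => /=; last by rewrite gt_eqF // divr_gt0.
  by rewrite sub0r normrN gtr0_norm ?divr_gt0 //; lra.
have [K hK] : exists K : R, forall i, `|c i| * a ^+ i <= K.
  have : cvgn (series (fun i => c i * a ^+ i)) by apply/cvg_ex; exists (f a).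
  move/cvg_series_cvg_0/cvgP/cvg_seq_bounded => [K [_ hK]]; exists (K + 1) => i.
  have := hK (K + 1); rewrite ltrDl ltr01 => /(_ isT i I).
  by rewrite /= normrM normrX (gtr0_norm a0).
have K0 : 0 <= K by apply: le_trans (hK 0%N); rewrite mulr_ge0 // exprn_ge0 // ltW.
move=> n; exists (2 * K / a ^+ n); near=> x.
have cvgx : (fun N : nat => \sum_(0 <= i < N) c i * x ^+ i) @ \oo --> f x by near: x.
have xa : `|x| <= a / 2 by near: x; apply: dnbhs0_le; rewrite divr_gt0.
have cvgd : (fun N => `|\sum_(0 <= i < N) c i * x ^+ i - (\poly_(i < n) c i).[x]|)
    @ \oo --> `|f x - (\poly_(i < n) c i).[x]|.
  by apply: cvg_norm; apply: cvgB => //; exact: cvg_cst.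
apply: (cvgr_to_le cvgd); near=> N.
have leN : (n <= N)%N by near: N; exact: nbhs_infty_ge.
rewrite horner_poly -(big_mkord xpredT (fun i => c i * x ^+ i)).
rewrite (big_cat_nat (n := n)) //= addrAC subrr add0r.
apply: le_trans (ler_norm_sum _ _ _) _.
pose q := `|x| / a.
have q0 : 0 <= q by rewrite divr_ge0 // ltW.
have q2 : q <= 1 / 2 by rewrite ler_pdivrMr //; lra.
have term i : `|c i * x ^+ i| <= K * q ^+ i.
  rewrite normrM normrX; have -> : `|x| = a * q by rewrite mulrC divfK // gt_eqF.
  by rewrite exprMn mulrA; apply: ler_wpM2r; rewrite ?exprn_ge0.
have -> : 2 * K / a ^+ n * `|x| ^+ n = 2 * K * q ^+ n by rewrite /q expr_div_n; ring.
(* The subtracted term makes the bound inductive: q <= 1/2 gives K q^N <= 2K q^N - 2K q^(N+1). *)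
apply: (@le_trans _ _ (2 * K * q ^+ n - 2 * K * q ^+ N)); last first.
  by rewrite gerBl mulr_ge0 ?exprn_ge0 // mulr_ge0.
rewrite -(subnKC leN); elim: (N - n)%N => [|m IHm].
  by rewrite addn0 big_geq // subrr.
rewrite addnS big_nat_recr ?leq_addr //=; apply: le_trans (lerD IHm (term _)) _.
rewrite exprS.
have h : q * q ^+ (n + m) <= 1 / 2 * q ^+ (n + m) by rewrite ler_wpM2r // exprn_ge0.
by have := ler_wpM2l K0 h; lra.
Unshelve. all: by end_near. Qed.

End AsymptoticExpansions.

(** * Expansions from the Bernoulli and Glaisher numbers *)

Section Coefficients.
Variable R : realType.
Implicit Types (c : nat -> R) (f : R -> R).

Lemma has_egf_expansion c f : has_egf c f -> has_expansion (fun j => c j / j`!%:R) f.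
Proof.
move=> hf; apply: power_series_expansion; apply: filterS hf => x.
have -> // : (fun N : nat => \sum_(0 <= i < N) c i * (x ^+ i / i`!%:R)) =
  (fun N : nat => \sum_(0 <= i < N) c i / i`!%:R * x ^+ i).
by apply/funext => N; apply: eq_bigr => i _; rewrite mulrA mulrAC.
Qed.

Lemma expR_expansion : has_expansion (fun j => (j`!%:R)^-1) (@expR R).
Proof.
apply: power_series_expansion; near=> x.
have := @is_cvg_series_exp_coeff R x.
by rewrite exp_coeffE /series; rewrite /expR exp_coeffE.
Unshelve. all: by end_near. Qed.

Definition sin_egf_coef (j : nat) : R := (odd j)%:R * (-1) ^+ j.-1./2 / j`!%:R.

Lemma sin_expansion : has_expansion sin_egf_coef (@sin R).
Proof.
apply: power_series_expansion; near=> x.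
have := @is_cvg_series_sin_coeff R x; rewrite sinE sin_coeffE.
by [].
Unshelve. all: by end_near. Qed.

Lemma norm_sin_bounds (x : R) : `|x| <= 1 -> `|x| / 2 <= `|sin x| <= `|x|.
Proof.
wlog x0 : x / 0 <= x => [wlg hx|].
  have [/wlg -> //|/ltW x0] := leP 0 x.
  by rewrite -normrN -(normrN (sin x)) -sinN; apply: wlg; rewrite ?oppr_ge0 // normrN.
rewrite ger0_norm // => x1; have := pihalf_ge1 R => p1.
have h : x / 2 <= sin x by apply: sin_ge_half; apply/andP; split; lra.
by rewrite ger0_norm ?h ?sin_le_id //; lra.
Qed.

Lemma sin_neq0_near0 : \forall x \near (0 : R)^', sin x != 0.
Proof.
near=> x.
have x1 : `|x| <= 1 by near: x; exact: dnbhs0_le.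
have x0 : 0 < `|x| by rewrite normr_gt0; near: x; exact: nbhs_dnbhs_neq.
by have /andP[h _] := norm_sin_bounds x1; rewrite -normr_gt0; lra.
Unshelve. all: by end_near. Qed.

Lemma sqr_neq1 (u : R) : 0 < u -> u != 1 ->
  [/\ u != 0, 1 - u != 0, 1 - u ^+ 2 != 0 & u ^+ 2 - 1 != 0].
Proof.
move=> u0 u1; have u2 : u ^+ 2 != 1.
  by rewrite -(expr1n R 2) eqrXn2 // ltW.
by rewrite gt_eqF // !subr_eq0 ![1 == _]eq_sym; split.
Qed.

Section Bernoulli.
Variables (B : nat -> R) (hB : is_bernoulli B).

(** The coefficients of x/sinh x, the function written as [csch_fun]. *)
Definition csch_coef (j : nat) : R := (2 - 2 ^+ j) * (B j / j`!%:R).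

Let csch_fun (x : R) : R :=
  2 * (x / (1 - expR (- x))) - 2 * x / (1 - expR (- (2 * x))).

Let csch_funE (x : R) : x != 0 -> csch_fun x = 2 * x * expR (- x) / (1 - expR (- x) ^+ 2).
Proof.
move=> x0; rewrite /csch_fun -[- (2 * x)]mulrN expRM_natl.
have u0 := expR_gt0 (- x).
have u1 : expR (- x) != 1 by rewrite -expR0 (inj_eq (@expR_inj R)) oppr_eq0.
have [h1 h2 h3 h4] := sqr_neq1 u0 u1; move: (expR _) h1 h2 h3 h4 => u h1 h2 h3 h4.
by field; rewrite h2 h3.
Qed.

Lemma csch_expansion : has_expansion csch_coef csch_fun.
Proof.
have hb := has_egf_expansion hB.
have n2 : (2 : R) != 0 by rewrite pnatr_eq0.
have := has_expansionD (has_expansionZ 2 hb) (has_expansionZ (-1) (has_expansion_scale n2 hb)).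
apply: eq_has_expansion => [j|]; first by rewrite /csch_coef; ring.
by apply: nearW => x; rewrite /csch_fun mulN1r.
Qed.

(** The function x/sinh x is even, so its expansion and the reflected one have the same
    coefficients. *)
Lemma csch_coef_odd (j : nat) : odd j -> csch_coef j = 0.
Proof.
move=> oj; have n1 : (-1 : R) != 0 by rewrite oppr_eq0 oner_eq0.
have : has_expansion (fun i => csch_coef i * (-1) ^+ i) csch_fun.
  apply: eq_has_expansion (has_expansion_scale n1 csch_expansion) => //.
  near=> x.
  have x0 : x != 0 by near: x; exact: nbhs_dnbhs_neq.
  rewrite !csch_funE ?mulN1r ?oppr_eq0 // opprK expRN.
  have u0 := expR_gt0 x.
  have u1 : expR x != 1 by rewrite -expR0 (inj_eq (@expR_inj R)).
  have [h1 h2 h3 h4] := sqr_neq1 u0 u1; move: (expR _) h1 h2 h3 h4 => u h1 h2 h3 h4.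
  by field; rewrite h1 h3 h4.
move=> h; have := has_expansion_unique csch_expansion h j; rewrite -signr_odd oj expr1 mulrN1 => /eqP.
by rewrite -subr_eq0 opprK -mulr2n mulrn_eq0 => /eqP.
Unshelve. all: by end_near. Qed.

(** Uniqueness of expansions turns (x/sinh x) sinh x = x into an identity between coefficients,
    where the rotation to the imaginary axis is a mere change of signs. *)
Lemma conv_csch_sinh :
  cauchy_prod csch_coef (fun j => (odd j)%:R / j`!%:R) =1 (fun j => ('X : {poly R})`_j).
Proof.
have n1 : (-1 : R) != 0 by rewrite oppr_eq0 oner_eq0.
have hsh : has_expansion (fun j => (odd j)%:R / j`!%:R) (fun x : R => (expR x - expR (- x)) / 2).
  have := has_expansionZ (2^-1) (has_expansionD expR_expansion
            (has_expansionZ (-1) (has_expansion_scale n1 expR_expansion))).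
  apply: eq_has_expansion => [j|].
    by rewrite -signr_odd; case: (odd j); rewrite /= ?expr1 ?expr0; field;
       rewrite pnatr_eq0 -lt0n fact_gt0.
  by apply: nearW => x; rewrite !mulN1r mulrC.
apply: has_expansion_unique (has_expansionM csch_expansion hsh) _.
apply: eq_has_expansion (has_expansion_horner 'X) => //.
near=> x.
have x0 : x != 0 by near: x; exact: nbhs_dnbhs_neq.
rewrite hornerX csch_funE // expRN.
have u0 := expR_gt0 x.
have u1 : expR x != 1 by rewrite -expR0 (inj_eq (@expR_inj R)).
have [h1 h2 h3 h4] := sqr_neq1 u0 u1; move: (expR _) h1 h2 h3 h4 => u h1 h2 h3 h4.
by field; rewrite h1 h4.
Unshelve. all: by end_near. Qed.

(* Substituting [i x] for [x] turns [x / sinh x] into [x / sin x]. *)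
Definition csc_coef (j : nat) : R := (-1) ^+ j./2 * csch_coef j.

(** Only terms with [i] even and [n - i] odd survive, and on these the signs multiply to
    [(-1) ^+ n.-1./2], which does not depend on [i]. *)
Lemma conv_csc_sin : cauchy_prod csc_coef sin_egf_coef =1 (fun j => ('X : {poly R})`_j).
Proof.
move=> n; transitivity ((-1) ^+ n.-1./2 * cauchy_prod csch_coef (fun j => (odd j)%:R / j`!%:R) n).
  rewrite /cauchy_prod mulr_sumr; apply: eq_bigr => -[i ltin] _ /=; rewrite /csc_coef /sin_egf_coef.
  have [oi|ei] := boolP (odd i); first by rewrite csch_coef_odd // !(mulr0, mul0r).
  have [od|ed] := boolP (odd (n - i)); last by rewrite !(mulr0, mul0r).
  have -> : n.-1./2 = (i./2 + (n - i).-1./2)%N by lia.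
  by rewrite exprD; ring.
rewrite conv_csch_sinh coefX; case: eqP => [->|_]; last by rewrite mulr0.
by rewrite expr0 mul1r.
Qed.

Lemma csc_expansion : has_expansion csc_coef (fun x => x / sin x).
Proof.
apply: (@has_expansion_div _ _ (fun j => ('X : {poly R})`_j) sin_egf_coef _ _ (1 / 2)).
- exact: conv_csc_sin.
- by rewrite divr_gt0.
- exact: sin_expansion.
- apply: eq_has_expansion (has_expansion_horner 'X) => //.
  by apply: nearW => x; rewrite hornerX.
near=> x; have x1 : `|x| <= 1 by near: x; exact: dnbhs0_le.
by have /andP[h _] := norm_sin_bounds x1; rewrite mul1r mulrC.
Unshelve. all: by end_near. Qed.

End Bernoulli.

Lemma glaisher_even (G : nat -> R) (hG : is_glaisherG G) (j : nat) : ~~ odd j -> G j = 0.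
Proof.
move=> ej; have n1 : (-1 : R) != 0 by rewrite oppr_eq0 oner_eq0.
have hg := has_egf_expansion hG.
have h := has_expansionZ (-1) (has_expansion_scale n1 hg).
have hh : has_expansion (fun i => -1 * (G i / i`!%:R * (-1) ^+ i)) (fun x : R => 3 * x / (2 + 4 * cos x)).
  apply: eq_has_expansion h => //; apply: nearW => x.
  by rewrite !mulN1r cosN mulrN mulNr opprK.
have := has_expansion_unique hg hh j.
rewrite -signr_odd (negbTE ej) expr0 mulr1 mulN1r => /eqP.
rewrite -subr_eq0 opprK -mulr2n mulrn_eq0 /= mulf_eq0 invr_eq0 pnatr_eq0.
by rewrite eqn0Ngt fact_gt0 orbF => /eqP.
Qed.

(** With F(y) = y/sin y and H(y) = 3y/(2 + 4 cos y), the function equals (F(3y) - 3F(y))/2 - (H(2y)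
    + 2H(y))/sqrt 3. The first part is even and the second odd, which is the case split in
    [gcoef]. *)
Lemma gcoef_expansion (B G : nat -> R) : is_bernoulli B -> is_glaisherG G ->
  has_expansion (fun j => gcoef B G j / j`!%:R)
    (fun y => - (y / sin y) - y / sin (pi / 3 + y)).
Proof.
move=> hB hG; have n2 : (2 : R) != 0 by rewrite pnatr_eq0.
have n3 : (3 : R) != 0 by rewrite pnatr_eq0.
have hF := csc_expansion hB; have hH := has_egf_expansion hG.
have hF2 := has_expansionZ (1 / 2) (has_expansionD (has_expansion_scale n3 hF) (has_expansionZ (-3) hF)).
have hH2 := has_expansionZ (- (1 / Num.sqrt 3)) (has_expansionD (has_expansion_scale n2 hH) (has_expansionZ 2 hH)).
apply: eq_has_expansion (has_expansionD hF2 hH2) => [j|].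
  rewrite /gcoef /csc_coef /csch_coef; case: ifPn => [oj|ej].
    have := csch_coef_odd hB oj; rewrite /csch_coef => ->; ring.
  by rewrite (glaisher_even hG ej); ring.
near=> y.
have y1 : `|y| <= 1 / 2 by near: y; apply: dnbhs0_le; rewrite divr_gt0.
have s0 : sin y != 0 by near: y; exact: sin_neq0_near0.
have s1 : `|sin y| <= 1 / 2.
  have /andP[_] : `|y| / 2 <= `|sin y| <= `|y| by apply: norm_sin_bounds; lra.
  by move=> h; exact: le_trans h y1.
have r0 : Num.sqrt 3 != 0 :> R by rewrite gt_eqF // sqrtr_gt0.
have r2 : Num.sqrt 3 ^+ 2 = 3 :> R by rewrite sqr_sqrtr.
have cs := cos2Dsin2 y.
have -> : sin (3 * y) = sin y * (3 - 4 * sin y ^+ 2) by rewrite sin_triple; ring.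
have -> : cos (2 * y) = cos y ^+ 2 *+ 2 - 1 by rewrite mulr_natl cos_mulr2n.
rewrite sinD sin_pi3 cos_pi3.
move: (sin y) (cos y) (Num.sqrt 3) s0 s1 r0 r2 cs => s c r s0 s1 r0 r2 cs.
have s2 : s ^+ 2 <= 1 / 4.
  by rewrite -real_normK ?num_real // (le_trans (lerXn2r 2 _ _ s1)) ?nnegrE //; lra.
(* [D] is a common denominator: sin 3y = D sin y, 2 + 4 cos 2y = 2D, (2 + 4 cos y)(2 cos y - 1) =
   2D, and sin(pi/3 + y) times 2(sqrt 3 cos y - sin y) is [D]. *)
pose D := 3 - 4 * s ^+ 2.
have D0 : D != 0 by rewrite /D gt_eqF //; lra.
have e1 : 2 + 4 * (c ^+ 2 *+ 2 - 1) = 2 * D.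
  by rewrite /D; have -> : c ^+ 2 = 1 - s ^+ 2 by [rewrite -cs addrK]; ring.
have inv (a b k : R) : a * b = k -> k != 0 -> a^-1 = b / k.
  move=> <-; rewrite mulf_eq0 negb_or => /andP[a0 b0]; by field; rewrite a0 b0.
have e2 : (2 + 4 * c)^-1 = (2 * c - 1) / (2 * D).
  apply: inv; last by rewrite mulf_neq0.
  have -> : (2 + 4 * c) * (2 * c - 1) = 2 * (4 * c ^+ 2 - 1) by ring.
  by rewrite /D; have -> : c ^+ 2 = 1 - s ^+ 2 by [rewrite -cs addrK]; ring.
have e3 : (r / 2 * c + 1 / 2 * s)^-1 = 2 * (r * c - s) / D.
  apply: inv => //.
  have -> : (r / 2 * c + 1 / 2 * s) * (2 * (r * c - s)) = r ^+ 2 * c ^+ 2 - s ^+ 2 by field.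
  by rewrite /D r2; have -> : c ^+ 2 = 1 - s ^+ 2 by [rewrite -cs addrK]; ring.
have e4 : 1 / r = r / 3 by rewrite -r2; field.
rewrite e1 e2 e3 e4 /D; rewrite /D in D0; field.
by rewrite s0 D0.
Unshelve. all: by end_near. Qed.

End Coefficients.

(** * Reduction to alternating sums *)

Section PartialFractions.
Variable R : comPzRingType.
Implicit Types s r : R.

Let side (p q : nat) s : R := \sum_(i < p.+1) s ^+ i.+1 *+ 'C(p + q - i, q).

Let side0l (q : nat) s : side 0 q s = s.
Proof. by rewrite /side big_ord1 add0n subn0 binn expr1. Qed.

Let side0r (p : nat) s : side p 0 s = \sum_(i < p.+1) s ^+ i.+1.
Proof. by apply: eq_bigr => i _; rewrite bin0. Qed.

Let sideS (p q : nat) s : side p.+1 q.+1 s = side p.+1 q s + side p q.+1 s.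
Proof.
rewrite /side [LHS]big_ord_recr [X in X + _]big_ord_recr /=.
rewrite !addKn !binn addrAC -big_split /=.
congr (_ + _); apply: eq_bigr => -[i ltip] _ /=; rewrite !addSn !addnS subSn.
  by rewrite binS mulrnDr addrC.
by rewrite ltnW // ltnS (leq_trans _ (leq_addr _ _)).
Qed.

(** Replacing one factor s r by s + r lowers either exponent by one, and by Pascal's rule [sideS]
    the right-hand side obeys the same recursion. If one exponent is 1, the expansion is a sum of
    powers. *)
Lemma partial_fractions (p q : nat) s r : s * r = s + r ->
  s ^+ p.+1 * r ^+ q.+1 =
  \sum_(i < p.+1) s ^+ i.+1 *+ 'C(p + q - i, q) +
  \sum_(i < q.+1) r ^+ i.+1 *+ 'C(q + p - i, p).
Proof.
rewrite -/(side p q s) -/(side q p r).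
have base (n : nat) (a b : R) : a * b = a + b -> a * b ^+ n.+1 = a + side n 0 b.
  move=> ab; elim: n => [|n IHn]; first by rewrite side0r big_ord1 expr1.
  by rewrite exprS mulrA ab mulrDl IHn !side0r [in RHS]big_ord_recr addrA -exprS.
move=> sr; elim: p q => [|p IHp] q; first by rewrite expr1 base // side0l.
elim: q => [|q IHq].
  by rewrite expr1 mulrC base 1?mulrC // 1?addrC // side0l addrC.
transitivity (s ^+ p.+2 * r ^+ q.+1 + s ^+ p.+1 * r ^+ q.+2).
  rewrite [s ^+ p.+2]exprSr [r ^+ q.+2]exprS -mulrA (mulrA s) sr; ring.
by rewrite IHq IHp !sideS; ring.
Qed.

End PartialFractions.

Lemma gbinomS (R : realType) (x : R) (m : nat) :
  gbinom x m.+1 = gbinom x m * (x - m%:R) / m.+1%:R.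
Proof.
rewrite /gbinom big_ord_recr /= factS natrM invfM.
by move: (\prod_(_ < _) _) => p; ring.
Qed.

Lemma gbinomN (R : realType) (K m : nat) :
  gbinom (- K.+1%:R : R) m = (-1) ^+ m * 'C(K + m, m)%:R.
Proof.
elim: m => [|m IHm].
  by rewrite /gbinom big_ord0 bin0 fact0 divr1 mulr1.
rewrite gbinomS IHm; have m0 : m.+1%:R != 0 :> R by rewrite pnatr_eq0.
apply: (mulIf m0); rewrite divfK // addnS -[in RHS]mulrA -natrM.
have -> : ('C((K + m).+1, m.+1) * m.+1 = (K + m).+1 * 'C(K + m, m))%N.
  by rewrite mulnC -mul_bin_diag.
rewrite natrM -addSn natrD exprS; ring.
Qed.

(** The hockey-stick identity, which yields the binomial of the [j = 0] term at the end. *)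
Lemma sum_bin_diag (K n : nat) : (\sum_(i < n.+1) 'C(K + i, K) = 'C((K + n).+1, K.+1))%N.
Proof.
elim: n => [|n IHn]; first by rewrite big_ord1 addn0 !binn.
by rewrite big_ord_recr /= IHn addnS [in RHS]binS.
Qed.

(** * Alternating sums over the nonzero integers and the Taylor remainder *)

Section AlternatingSums.
Variable R : realType.
Implicit Types (f g : R -> R) (M : nat).

Definition alt_sum M f : R :=
  \sum_(1 <= m < M.+1) (-1) ^+ m * (f m%:R + f (- m%:R)).

Lemma eq_alt_sum M f g :
  (forall (m : nat) r, (0 < m)%N -> `|r| = m%:R -> f r = g r) -> alt_sum M f = alt_sum M g.
Proof.
move=> fg; apply: eq_big_nat => m /andP[m0 _].
by rewrite !(fg m) ?normrN // ger0_norm.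
Qed.

Lemma alt_sumD M f g : alt_sum M (fun r => f r + g r) = alt_sum M f + alt_sum M g.
Proof. by rewrite /alt_sum -big_split; apply: eq_bigr => m _; rewrite /=; ring. Qed.

Lemma alt_sumZ M (a : R) f : alt_sum M (fun r => a * f r) = a * alt_sum M f.
Proof. by rewrite /alt_sum mulr_sumr; apply: eq_bigr => m _; ring. Qed.

Lemma alt_sum_sum M (n : nat) (f : 'I_n -> R -> R) :
  alt_sum M (fun r => \sum_(i < n) f i r) = \sum_(i < n) alt_sum M (f i).
Proof.
rewrite /alt_sum exchange_big; apply: eq_bigr => m _ /=.
by rewrite -mulr_sumr big_split.
Qed.

Lemma alt_sum_opp M f : alt_sum M (fun r => f (- r)) = alt_sum M f.
Proof. by apply: eq_bigr => m _; rewrite opprK addrC. Qed.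

Lemma alt_sum_bound M f (A : R) :
  (forall (m : nat) r, (0 < m)%N -> `|r| = m%:R -> `|f r| <= A / m%:R ^+ 2) ->
  0 <= A -> `|alt_sum M f| <= 4 * A.
Proof.
move=> fA A0; apply: le_trans (ler_norm_sum _ _ _) _.
apply: (@le_trans _ _ (2 * A * \sum_(1 <= m < M.+1) (m%:R ^+ 2)^-1)).
  rewrite mulr_sumr !big_nat; apply: ler_sum => m /andP[m0 _].
  rewrite normrM normrX normrN1 expr1n mul1r; apply: le_trans (ler_normD _ _) _.
  have h1 : `|f m%:R| <= A / m%:R ^+ 2 by apply: fA => //; rewrite ger0_norm.
  have h2 : `|f (- m%:R)| <= A / m%:R ^+ 2 by apply: fA => //; rewrite normrN ger0_norm.
  by rewrite -mulrA mulr_natl mulr2n lerD.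
have h : 0 <= 2 * A by rewrite mulr_ge0.
by have := ler_wpM2l h (sum_inv_sqr_le2 R M); lra.
Qed.

Lemma csc_sum_alt M (z : R) : csc_sum M z = z^-1 + alt_sum M (fun r => (z + r)^-1).
Proof. by []. Qed.

Lemma geometric_expansion (b x : R) (n : nat) : b != 0 -> b + x != 0 ->
  - (b + x)^-1 = \sum_(l < n) (-1) ^+ l.+1 * (b ^+ l.+1)^-1 * x ^+ l
    + (-1) ^+ n.+1 * (b ^+ n * (b + x))^-1 * x ^+ n.
Proof.
move=> b0 bx0; elim: n => [|n IHn].
  by rewrite big_ord0 add0r !expr0 expr1 mul1r mulr1 mulN1r.
rewrite IHn big_ord_recr /= -addrA; congr (_ + _).
by rewrite !exprS; field; rewrite bx0 expf_neq0.
Qed.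

(* The Taylor coefficients at 0 of [1/x - csc_sum M x - csc_sum M (1/3 + x)]; the
   pole of [csc_sum M] at 0 cancels [1/x], so that the first sum omits [r = 0]. *)
Definition csc_taylor M (l : nat) : R := (-1) ^+ l.+1 *
  (alt_sum M (fun r => (r ^+ l.+1)^-1) + (1 / 3) ^- l.+1
   + alt_sum M (fun r => ((1 / 3 + r) ^+ l.+1)^-1)).

(** The point is that [C] does not depend on [M]. Up to sign, 1/(b + x) has remainder
    x^(n+1)/(b^(n+1) (b + x)), and both denominators are at least m/2 in absolute value, so the
    remainders are summable like 1/m^2. *)
Lemma csc_taylor_remainder (n : nat) : exists C : R, forall M x, 0 < `|x| <= 1 / 6 ->
  `|x^-1 - csc_sum M x - csc_sum M (1 / 3 + x) - \sum_(l < n.+1) csc_taylor M l * x ^+ l|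
  <= C * `|x| ^+ n.+1.
Proof.
(* Each alternating sum contributes [4 * 2 ^+ n.+2]; the single fraction with b = 1/3 contributes
   the rest, as |1/3 + x| >= 1/6. *)
exists (8 * 2 ^+ n.+2 + 6 * 3 ^+ n.+1) => M x /andP[x0 x6].
have A0 : 0 <= 2 ^+ n.+2 :> R by rewrite exprn_ge0.
have far (m : nat) (b : R) : (0 < m)%N -> m%:R / 2 <= `|b| -> 0 < `|b|.
  by move=> m0; apply: lt_le_trans; rewrite divr_gt0 // ltr0n.
have term (m : nat) (b b' : R) : (0 < m)%N -> m%:R / 2 <= `|b| -> m%:R / 2 <= `|b'| ->
    `|(b ^+ n.+1 * b')^-1| <= 2 ^+ n.+2 / m%:R ^+ 2.
  move=> m0 hb hb'; have m0' : 0 < m%:R :> R by rewrite ltr0n.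
  have -> : 2 ^+ n.+2 / m%:R ^+ 2 = (m%:R ^+ 2 * (1 / 2) ^+ n.+2)^-1 :> R.
    by rewrite expr_div_n expr1n [RHS]invfM invf_div divr1 mulrC.
  have d0 : 0 < `|b ^+ n.+1 * b'|.
    by rewrite normrM normrX mulr_gt0 ?exprn_gt0 ?(far _ _ m0).
  have e0 : 0 < m%:R ^+ 2 * (1 / 2) ^+ n.+2 :> R by rewrite mulr_gt0 ?exprn_gt0 ?divr_gt0.
  rewrite normfV lef_pV2 ?posrE //.
  rewrite normrM normrX.
  apply: (@le_trans _ _ ((m%:R / 2) ^+ n.+1 * (m%:R / 2))); last first.
    by apply: ler_pM; rewrite ?exprn_ge0 ?lerXn2r ?nnegrE // divr_ge0.
  rewrite -exprSr !expr_div_n expr1n mul1r; apply: ler_wpM2r; first by rewrite invr_ge0 exprn_ge0.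
  by rewrite -!natrX ler_nat leq_pexp2l.
have dist (m : nat) (r y : R) : (0 < m)%N -> `|r| = m%:R -> `|y| <= 1 / 2 -> m%:R / 2 <= `|y + r|.
  move=> m0 hr hy; have m1 : 1 <= m%:R :> R by rewrite ler1n.
  have : `|r| <= `|y + r| + `|y|.
    by rewrite -[X in `|X|](addKr y) addrC -(normrN y) ler_normD.
  by rewrite hr; lra.
have x2 : `|x| <= 1 / 2 by lra.
have a2 : `|1 / 3| <= 1 / 2 :> R by rewrite ger0_norm; lra.
have ax2 : `|1 / 3 + x| <= 1 / 2.
  by apply: le_trans (ler_normD _ _) _; rewrite [`|1 / 3|]ger0_norm; lra.
have ax6 : 1 / 6 <= `|1 / 3 + x|.
  by move: x6; rewrite ler_norml => /andP[? ?]; rewrite ger0_norm; lra.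
have dist0 (m : nat) (r : R) : (0 < m)%N -> `|r| = m%:R -> m%:R / 2 <= `|r|.
  by move=> m0 hr; have := dist m r 0 m0 hr; rewrite normr0 add0r; apply; lra.
pose rem (b : R) := (b ^+ n.+1 * (b + x))^-1.
pose cf (b : R) := \sum_(l < n.+1) (-1) ^+ l.+1 * (b ^+ l.+1)^-1 * x ^+ l.
have geo (b : R) : 0 < `|b| -> 0 < `|b + x| ->
    (b + x)^-1 = - cf b + (-1) ^+ n.+1 * x ^+ n.+1 * rem b.
  rewrite !normr_gt0 => b0 bx0; apply: oppr_inj.
  rewrite (@geometric_expansion b x n.+1 b0 bx0) opprD opprK /cf /rem; congr (_ + _).
  by rewrite exprS; ring.
pose rems := alt_sum M rem + rem (1 / 3) + alt_sum M (fun r => rem (1 / 3 + r)).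
have -> : x^-1 - csc_sum M x - csc_sum M (1 / 3 + x)
      - \sum_(l < n.+1) csc_taylor M l * x ^+ l = (-1) ^+ n * x ^+ n.+1 * rems.
  have -> : csc_sum M x = x^-1 + (- alt_sum M cf + (-1) ^+ n.+1 * x ^+ n.+1 * alt_sum M rem).
    rewrite csc_sum_alt; congr (_ + _).
    transitivity (alt_sum M (fun r => -1 * cf r + (-1) ^+ n.+1 * x ^+ n.+1 * rem r)).
      apply: eq_alt_sum => m r m0 hr; rewrite addrC mulN1r; apply: geo.
        exact: (far m _ m0 (dist0 _ _ m0 hr)).
      by rewrite addrC; exact: (far m _ m0 (dist _ _ _ m0 hr x2)).
    by rewrite alt_sumD !alt_sumZ mulN1r.
  have -> : csc_sum M (1 / 3 + x) = - cf (1 / 3) + (-1) ^+ n.+1 * x ^+ n.+1 * rem (1 / 3) +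
     (- alt_sum M (fun r => cf (1 / 3 + r)) +
       (-1) ^+ n.+1 * x ^+ n.+1 * alt_sum M (fun r => rem (1 / 3 + r))).
    rewrite csc_sum_alt; congr (_ + _).
      by apply: geo; [rewrite gtr0_norm // divr_gt0|lra].
    transitivity (alt_sum M (fun r => -1 * cf (1 / 3 + r)
        + (-1) ^+ n.+1 * x ^+ n.+1 * rem (1 / 3 + r))).
      apply: eq_alt_sum => m r m0 hr; rewrite addrAC mulN1r; apply: geo.
        exact: (far m _ m0 (dist _ _ _ m0 hr a2)).
      by rewrite addrAC; exact: (far m _ m0 (dist _ _ _ m0 hr ax2)).
    by rewrite alt_sumD !alt_sumZ mulN1r.
  have -> : \sum_(l < n.+1) csc_taylor M l * x ^+ l =
      alt_sum M cf + cf (1 / 3) + alt_sum M (fun r => cf (1 / 3 + r)).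
    have cf_sum (g : R -> R) : alt_sum M (fun r => cf (g r)) = \sum_(l < n.+1)
        (-1) ^+ l.+1 * x ^+ l * alt_sum M (fun r => ((g r) ^+ l.+1)^-1).
      rewrite alt_sum_sum; apply: eq_bigr => l _; rewrite -alt_sumZ.
      by apply: eq_alt_sum => m r _ _; rewrite mulrAC.
    rewrite (cf_sum id) cf_sum /cf -!big_split; apply: eq_bigr => l _ /=.
    by rewrite /csc_taylor; ring.
  by rewrite /rems exprS; ring.
rewrite -mulrA normrM normrX normrN1 expr1n mul1r normrM normrX mulrC.
apply: ler_wpM2r; first by rewrite exprn_ge0.
have b1 : `|alt_sum M rem| <= 4 * 2 ^+ n.+2.
  apply: alt_sum_bound => // m r m0 hr; apply: term => //; first exact: dist0.
  by rewrite addrC; exact: dist.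
have b2 : `|alt_sum M (fun r => rem (1 / 3 + r))| <= 4 * 2 ^+ n.+2.
  apply: alt_sum_bound => // m r m0 hr; apply: term => //; first exact: dist.
  by rewrite addrAC; exact: dist.
have b3 : `|rem (1 / 3)| <= 6 * 3 ^+ n.+1.
  rewrite /rem invfM normrM -exprVn invf_div divr1 normrX ger0_norm // mulrC.
  apply: ler_wpM2r; first by rewrite exprn_ge0.
  by rewrite normfV -[6]invrK lef_pV2 ?posrE ?invr_gt0 //; lra.
apply: le_trans (ler_normD _ _) _; have := ler_normD (alt_sum M rem) (rem (1 / 3)).
by lra.
Qed.

End AlternatingSums.

(** Induction on [i]: the lower coefficients already converge. Fix a small x for which the
    remainders, uniform in [N], use up half of the tolerance; convergence of [H N x] at this single
    x supplies the other half. *)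
Lemma cvg_expansion_coef (R : realType) (u : nat -> nat -> R) (H : nat -> R -> R)
    (c : nat -> R) (h : R -> R) :
  (forall i, exists C : R, \forall x \near 0^', forall N,
     `|H N x - \sum_(l < i.+1) u N l * x ^+ l| <= C * `|x| ^+ i.+1) ->
  (\forall x \near 0^', (fun N => H N x) @ \oo --> h x) ->
  has_expansion c h ->
  forall i, (fun N => u N i) @ \oo --> c i.
Proof.
move=> Hu Hh hc; apply: ltn_ind => i IHi; apply/cvgrPdist_le => e e0.
have [C hC] := Hu i; have [D hD] := hc i.+1.
have : \forall x \near (0 : R)^', \forall N \near \oo, `|c i - u N i| <= e.
  near=> x.
  have x0 : 0 < `|x| by rewrite normr_gt0; near: x; exact: nbhs_dnbhs_neq.
  have hCx : forall N, `|H N x - \sum_(l < i.+1) u N l * x ^+ l| <= C * `|x| ^+ i.+1 by near: x.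
  have hDx : `|h x - (\poly_(l < i.+1) c l).[x]| <= D * `|x| ^+ i.+1 by near: x.
  have hx : `|x| < e / 2 / (`|C + D| + 1).
    by near: x; apply: dnbhs0_lt; rewrite !divr_gt0 // ltr_wpDl.
  have Hhx : (fun N => H N x) @ \oo --> h x by near: x.
  have low : (fun N => H N x - \sum_(l < i) u N l * x ^+ l) @ \oo -->
      h x - \sum_(l < i) c l * x ^+ l.
    apply: cvgB Hhx _; apply: (cvg_big add_continuous) => l _.
    by apply: cvgMr_tmp; exact: IHi.
  have e1 : 0 < e / 2 * `|x| ^+ i by rewrite mulr_gt0 ?divr_gt0 ?exprn_gt0.
  move/cvgrPdist_le: low => /(_ _ e1); apply: filterS => N.
  rewrite horner_poly !big_ord_recr /= in hDx; move: (hCx N); rewrite big_ord_recr /=.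
  move: hDx; move: (\sum_(_ < _) _) (\sum_(_ < _) _) (H N x) (h x) => p q a b hp hq hpq.
  rewrite -(ler_pM2r (exprn_gt0 i x0)) -normrX -normrM normrX.
  have small : (C + D) * `|x| ^+ i.+1 <= e / 2 * `|x| ^+ i.
    rewrite exprS mulrA; apply: ler_wpM2r; first by rewrite exprn_ge0.
    move: hx; rewrite ltr_pdivlMr ?ltr_wpDl // => hx.
    have : (C + D) * `|x| <= `|C + D| * `|x| by rewrite ler_wpM2r // ler_norm.
    have := normr_ge0 x; lra.
  move: hp hq hpq small; rewrite mulrBl mulrDl.
  move: (`|x| ^+ i) (`|x| ^+ i.+1) (c i * x ^+ i) (u N i * x ^+ i) => y z v w.
  rewrite !ler_norml => /andP[? ?] /andP[? ?] /andP[? ?] ?.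
  by apply/andP; split; lra.
by move/filter_ex => [].
Unshelve. all: by end_near. Qed.

(** * Passage to the limit *)

Section Limit.
Variables (R : realType) (B G : nat -> R).
Hypotheses (hB : is_bernoulli B) (hG : is_glaisherG G).

(** The value is [- B 0], and [B 0 = 1] is the degree 1 coefficient of (x/sin x) sin x = x. *)
Lemma gcoef0 : gcoef B G 0 = -1.
Proof.
have := conv_csc_sin hB 1%N.
rewrite /cauchy_prod !big_ord_recr big_ord0 /= coefX /csc_coef /csch_coef /sin_egf_coef /gcoef /=.
rewrite !expr0 !fact0 !mul1r !mul0r mulr0 addr0 add0r !divr1 mulr1 => h.
by move: h; rewrite mulr1n; lra.
Qed.

(** Substitute y = pi x in [gcoef_expansion], remove the constant term -1 and divide by x: this
    gives the limit of the functions in [csc_taylor_remainder] and shifts the index from [l] to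
    [l.+1]. *)
Lemma cvg_csc_taylor (l : nat) :
  (fun n => csc_taylor R (repunit3 n) l) @ \oo --> pi ^+ l.+1 * (gcoef B G l.+1 / l.+1`!%:R).
Proof.
have pi0 := pi_gt0 R; have pin0 : pi != 0 :> R by rewrite gt_eqF.
have hg := has_expansion_shift (has_expansion_scale pin0 (gcoef_expansion hB hG)).
rewrite mulrC; move: l; apply: (cvg_expansion_coef _ _ hg).
  move=> i; have [C hC] := csc_taylor_remainder R i; exists C; near=> x => N.
  apply: hC; rewrite normr_gt0; apply/andP; split; near: x; first exact: nbhs_dnbhs_neq.
  by apply: dnbhs0_le; rewrite divr_gt0.
near=> x.
have x6 : `|x| <= 1 / 6 by near: x; apply: dnbhs0_le; rewrite divr_gt0.
have x0 : x != 0 by near: x; exact: nbhs_dnbhs_neq.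
rewrite expr0 fact0 divr1 mulr1 gcoef0.
have -> : (- (pi * x / sin (pi * x)) - pi * x / sin (pi / 3 + pi * x) - -1) / x
    = x^-1 - pi / sin (pi * x) - pi / sin (pi * (1 / 3 + x)).
  rewrite mulrDr mulrA mulr1; move: (sin _)^-1 (sin _)^-1 => a b; by field.
apply: cvgB; first apply: cvgB; first exact: cvg_cst.
  by apply: cvg_csc_sum; rewrite normr_gt0 x0 /=; lra.
apply: cvg_csc_sum; move: x6; rewrite ler_norml => /andP[? ?].
by rewrite gtr0_norm; [apply/andP; split|]; lra.
Unshelve. all: by end_near. Qed.

End Limit.

Lemma sum_euler_coef_taylor (R : realType) (K M : nat) :
  \sum_(1 <= n < (pent_plus M).+1) (euler_coef n)%:~R / n%:R ^+ K.+1 =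
  (-6) ^+ K.+1 * \sum_(i < K.+1) 'C(K + K - i, K)%:R / 3 ^+ i.+1
    * ((-1) ^+ i.+1 * csc_taylor R M i - 3 ^+ i.+1) :> R.
Proof.
rewrite (sum_euler_coef (fun n => (n%:R ^+ K.+1)^-1 : R)).
(* r(3r + 1)/2 is [pent_plus m] at [r = m] and [pent_minus m] at [r = - m]. *)
transitivity (alt_sum M (fun r : R => ((r * (3 * r + 1) / 2) ^+ K.+1)^-1)).
  apply: eq_bigr => m _; rewrite [X in _ * X]addrC.
  have ppE : (pent_plus m)%:R * 2 = 3 * m%:R ^+ 2 + m%:R :> R.
    by rewrite -natrX -!natrM -natrD pent_plusE.
  have pmE : (pent_minus m)%:R * 2 + m%:R = 3 * m%:R ^+ 2 :> R.
    by rewrite -natrX -!natrM -natrD pent_minusE.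
  congr (_ * (_^-1 + _^-1)); congr (_ ^+ _).
    apply: (mulIf (_ : 2 != 0 :> R)); rewrite ?pnatr_eq0 // divfK ?pnatr_eq0 //.
    by rewrite ppE; ring.
  apply: (mulIf (_ : 2 != 0 :> R)); rewrite ?pnatr_eq0 // divfK ?pnatr_eq0 //.
  by apply: (addIr m%:R); rewrite pmE; ring.
transitivity (alt_sum M (fun r : R => (-6) ^+ K.+1 * \sum_(i < K.+1)
   'C(K + K - i, K)%:R / 3 ^+ i.+1 *
     ((-1) ^+ i.+1 * (r ^+ i.+1)^-1 + ((1 / 3 + r) ^+ i.+1)^-1))).
  apply: eq_alt_sum => m r m0 hr.
  have m1 : 1 <= m%:R :> R by rewrite ler1n.
  have r0 : r != 0 by rewrite -normr_gt0 hr; lra.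
  have r1 : 3 * r + 1 != 0.
    apply/eqP => h; have r13 : r = - (1 / 3) by lra.
    by move: hr; rewrite r13 normrN ger0_norm; lra.
  (* The factor -6 comes from 2/(r(3r + 1)) = -6 s t. *)
  pose s : R := - (3 * r)^-1; pose t : R := (3 * r + 1)^-1.
  have st : s * t = s + t by rewrite /s /t; field; rewrite r0 r1.
  have -> : ((r * (3 * r + 1) / 2) ^+ K.+1)^-1 = (-6) ^+ K.+1 * (s ^+ K.+1 * t ^+ K.+1).
    by rewrite -!exprMn -exprVn /s /t; congr (_ ^+ _); field; rewrite r0 r1.
  rewrite partial_fractions // -big_split /=; congr (_ * _); apply: eq_bigr => i _.
  have -> : (1 / 3 + r) ^+ i.+1 = (3 * r + 1) ^+ i.+1 / 3 ^+ i.+1.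
    by rewrite -expr_div_n; congr (_ ^+ _); field.
  rewrite /s /t (exprNn (3 * r)^-1) !exprVn exprMn -mulrnDl -[LHS]mulr_natl.
  have p0 : r ^+ i.+1 != 0 by rewrite expf_neq0.
  have q0 : (3 * r + 1) ^+ i.+1 != 0 by rewrite expf_neq0.
  have n0 : 3 ^+ i.+1 != 0 :> R by rewrite expf_neq0 ?pnatr_eq0.
  move: p0 q0 n0; move: (r ^+ _) ((3 * r + 1) ^+ _) (3 ^+ _ : R) ((-1) ^+ _ : R) => p q n e p0 q0 n0.
  by field; rewrite p0 q0 n0.
rewrite alt_sumZ alt_sum_sum; congr (_ * _); apply: eq_bigr => i _.
rewrite alt_sumZ; congr (_ * _); rewrite alt_sumD alt_sumZ /csc_taylor.
(* For odd exponents this sum vanishes by the symmetry r -> -r, so the sign may be inserted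
   freely. *)
have par : alt_sum M (fun r : R => (r ^+ i.+1)^-1) = (-1) ^+ i.+1 * alt_sum M (fun r : R => (r ^+ i.+1)^-1).
  rewrite -alt_sumZ -[LHS]alt_sum_opp; apply: eq_alt_sum => m r _ _.
  by rewrite /= (exprNn r) invfM -exprVn invrN invr1.
have sq : (-1) ^+ i.+1 * (-1) ^+ i.+1 = 1 :> R by rewrite -expr2 sqrr_sign.
have -> : (1 / 3) ^- i.+1 = 3 ^+ i.+1 :> R by rewrite expr_div_n expr1n invf_div divr1.
by rewrite -par !mulrA sq mul1r; ring.
Qed.

Theorem theorem3p1 (R : realType) (B G : nat -> R)
    (hB : is_bernoulli B) (hG : is_glaisherG G) (k : nat) (hk : (0 < k)%N) :
  (fun N : nat => \sum_(1 <= n < N) (euler_coef n)%:~R / n%:R ^+ k : R) @ \oo -->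
  \sum_(0 <= j < k.+1)
     6 ^+ (k - j) * gbinom (- k%:R) (k - j) * ((2 * pi) ^+ j / j`!%:R)
       * gcoef B G j.
Proof.
set s := fun N : nat => _; set L := \sum_(_ <= _ < _) _.
have cvgs : cvgn s by exact: cvg_sum_euler_coef.
(* Since the whole series converges, its limit may be computed along these indices, where the finite
   identities are exact. *)
suff lim : (fun n => s (pent_plus (repunit3 n)).+1) @ \oo --> L.
  suff -> : L = limn s by [].
  apply: cvg_unique lim _ => //; apply: cvg_comp cvgs.
  apply/cvgnyPge => A; exists A => // n /= leAn; apply: leq_trans leAn _.
  have len : (n <= repunit3 n)%N.
    by elim: n => // n IHn; rewrite /repunit3 iterS -/(repunit3 n); lia.
  have := pent_plus_ge (repunit3 n); nia.
case: k hk @s @L cvgs => // K _ s L _.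
rewrite /s; under eq_fun do rewrite sum_euler_coef_taylor.
rewrite (_ : L = (-6) ^+ K.+1 * \sum_(i < K.+1) 'C(K + K - i, K)%:R / 3 ^+ i.+1
    * ((-1) ^+ i.+1 * (pi ^+ i.+1 * (gcoef B G i.+1 / i.+1`!%:R)) - 3 ^+ i.+1)).
  apply: cvgMl_tmp; apply: (cvg_big add_continuous) => i _; apply: cvgMl_tmp; apply: cvgB; last exact: cvg_cst.
  by apply: cvgMl_tmp; exact: cvg_csc_taylor.
(* The [j = 0] term of [L] matches the corrections [- 3 ^+ i.+1], and the term [j = i.+1] matches
   the limit of the [i]-th Taylor coefficient. *)
rewrite /L big_ltn // subn0 gcoef0 // gbinomN expr0 fact0 divr1 mulr1 mulrN1.
have -> : 'C(K + K.+1, K.+1)%:R = \sum_(i < K.+1) 'C(K + K - i, K)%:R :> R.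
  rewrite addnS -sum_bin_diag natr_sum (reindex_inj rev_ord_inj) /=.
  by apply: eq_bigr => i _; rewrite subSS addnBA // -ltnS.
rewrite big_add1 big_mkord /=; set S := \sum_(i < K.+1) 'C(_, _)%:R.
under [in RHS]eq_bigr => i _ do rewrite mulrBr divfK ?expf_neq0 ?pnatr_eq0 //.
rewrite sumrB mulrBr addrC; congr (_ - _); last first.
  by rewrite mulrA -exprMn mulrN1.
rewrite mulr_sumr; apply: eq_bigr => -[i ltiK] _ /=.
have leiK : (i <= K)%N by rewrite -ltnS.
have -> : ('C(K + K - i, K) = 'C(K + (K - i), K - i))%N.
  by rewrite -addnBA // -bin_sub ?leq_addr // addKn.
rewrite subSS gbinomN.
(* The power [K - i] provides the factor 6^(k-j) and the sign of the binomial; of the remaining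
   power, 3^j cancels the denominator and 2^j joins pi^j. *)
have -> : (-6) ^+ K.+1 = (-1) ^+ (K - i) * 6 ^+ (K - i) * ((-1) ^+ i.+1 * (2 ^+ i.+1 * 3 ^+ i.+1)) :> R.
  rewrite -[in LHS](subnK leiK) -addnS exprD -!exprMn !mulN1r -natrM //.
have n3 : 3 ^+ i.+1 != 0 :> R by rewrite expf_neq0 ?pnatr_eq0.
have sq : (-1) ^+ i.+1 * (-1) ^+ i.+1 = 1 :> R by rewrite -expr2 sqrr_sign.
rewrite exprMn -[LHS]mul1r -[X in X * _ = _]sq.
move: n3; move: (3 ^+ i.+1 : R) => n n3; move: ((-1) ^+ i.+1 : R) (i.+1`!%:R^-1 : R) => e f.
by field.
Qed.
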